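(* Let $G$ be a real projective profinite group, and let $p$ be a prime number. Then the differential graded $\mathbb{F}_p$-algebra $C^*(G,\mathbb{F}_p)$ of continuous cochains of $G$ with values in $\mathbb{F}_p$ satisfies strong Massey vanishing for cohomology classes in arbitrary degrees.
   Context: Real projective: Let $G$ be a profinite group. An embedding problem for $G$ consists of finite groups $\widetilde{H}, H$, a continuous homomorphism $\phi\colon G\to H$ and a surjective homomorphism $\alpha\colon\widetilde{H}\to H$. A solution is a continuous homomorphism $\widetilde\phi\colon G\to\widetilde H$ with $\alpha\circ\widetilde\phi=\phi$. The embedding problem is real if for every involution $t\in G$ with $\phi(t)\neq 1$ there is an involution $\tilde h\in\widetilde H$ with $\alpha(\tilde h)=\phi(t)$. The group $G$ is real projective if $G$ has an open subgroup without $2$-torsion and every real embedding problem for $G$ has a solution. Massey products: Let $(C^*,\cup,\delta)$ be a differential graded associative algebra over a field, with cohomology $H^*$. For $a\in C^d$ write $\bar a=(-1)^{1+d}a$. Let $n\ge2$ and let $a_i\in H^{d_i}$ for $i=1,\dots,n$. A defining system for the $n$-fold Massey product of $a_1,\dots,a_n$ is a set of elements $a_{i,j}\in C^{d_{i,j}}$, for $1\le i<j\le n+1$ with $(i,j)\ne(1,n+1)$, where $d_{i,j}=\sum_{s=i}^{j-1}d_s-(j-1-i)$, such that $\delta(a_{i,j})=\sum_{k=i+1}^{j-1}\bar a_{i,k}\cup a_{k,j}$ and $a_{i,i+1}$ represents $a_i$ for each $i$. The associated Massey product is the cohomology class of $\sum_{k=2}^n\bar a_{1,k}\cup a_{k,n+1}$,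 of degree $\sum_{i=1}^n d_i-n+2$. The set $\langle a_1,\dots,a_n\rangle$ consists of these classes for all defining systems. The $n$-fold Massey product of $a_1,\dots,a_n$ vanishes if $0\in\langle a_1,\dots,a_n\rangle$ (in particular, a defining system exists). $C^*$ satisfies strong Massey vanishing if for all $n\ge 2$ and all cohomology classes $a_1,\dots,a_n$ of any degrees with $a_1\cup a_2=a_2\cup a_3=\cdots=a_{n-1}\cup a_n=0$ in $H^*$, the $n$-fold Massey product of $a_1,\dots,a_n$ vanishes. *)

(* Defs.v *)
From HB Require Import structures.
From mathcomp Require Import all_boot all_order all_fingroup all_algebra.
From mathcomp Require Import generic_quotient ring_quotient.
From mathcomp Require Import all_classical topology zify ring.

Set Implicit Arguments.
Unset Strict Implicit.
Unset Printing Implicit Defensive.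

Import Order.TTheory GRing.Theory.

Local Open Scope classical_set_scope.
Local Open Scope ring_scope.
Local Open Scope quotient_scope.

HB.mixin Record isTopologicalGroup G of Topological G & monoid.Group G := {
  mulg_continuous : continuous (fun x : G * G => (x.1 * x.2)%g);
  invg_continuous : continuous (fun x : G => x^-1%g)
}.

#[short(type="topologicalGroupType")]
HB.structure Definition TopologicalGroup :=
  {G of isTopologicalGroup G & Topological G & monoid.Group G}.

HB.mixin Record isProfinite G of TopologicalGroup G := {
  profinite_compact : compact [set: G];
  profinite_hausdorff : hausdorff_space G;
  profinite_totally_disconnected : totally_disconnected [set: G]
}.

#[short(type="profiniteGroupType")]
HB.structure Definition ProfiniteGroup :=
  {G of isProfinite G & TopologicalGroup G}.

Definition involution (G : groupType) (t : G) : Prop :=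
  t <> 1%g /\ (t * t)%g = 1%g.

Definition is_subgroup (G : groupType) (U : set G) : Prop :=
  [/\ U 1%g, forall x y, U x -> U y -> U (x * y)%g
    & forall x, U x -> U x^-1%g].

Record embeddingProblem (G : topologicalGroupType) := EmbeddingProblem {
  ep_cover : finGroupType;
  ep_base : finGroupType;
  ep_phi : {multiplicative G -> ep_base};
  ep_phi_continuous : continuous (ep_phi : G -> discrete_topology ep_base);
  ep_alpha : {multiplicative ep_cover -> ep_base};
  ep_alpha_surjective : forall h, exists h', ep_alpha h' = h
}.

Definition solvable_ep (G : topologicalGroupType) (E : embeddingProblem G) :=
  exists psi : {multiplicative G -> ep_cover E},
    continuous (psi : G -> discrete_topology (ep_cover E)) /\
    forall g, ep_alpha E (psi g) = ep_phi E g.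

Definition real_ep (G : topologicalGroupType) (E : embeddingProblem G) :=
  forall t : G, involution t -> ep_phi E t <> 1%g ->
    exists h : ep_cover E, involution h /\ ep_alpha E h = ep_phi E t.

Definition real_projective (G : profiniteGroupType) : Prop :=
  (exists U : set G,
     [/\ is_subgroup U, open U & forall t, U t -> ~ involution t]) /\
  (forall E : embeddingProblem G, real_ep E -> solvable_ep E).

(** The underlying algebra is the internal direct sum of its homogeneous
    components [dg_homog d], indexed by all integers so that the degrees
    occurring in defining systems, which may be negative, make sense. *)
Record dgAlgebra (F : fieldType) := DGAlgebra {
  dg_sort :> algType F;
  dg_homog : int -> set dg_sort;
  dg_diff : {linear dg_sort -> dg_sort};
  dg_homog0 : forall d, dg_homog d 0;
  dg_homogP : forall d (c : F) x y,
    dg_homog d x -> dg_homog d y -> dg_homog d (c *: x + y);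
  dg_homog1 : dg_homog 0 1;
  dg_homogM : forall d e x y,
    dg_homog d x -> dg_homog e y -> dg_homog (d + e) (x * y);
  dg_span : forall x, exists (r : seq int) (y : int -> dg_sort),
    (forall d, dg_homog d (y d)) /\ x = \sum_(d <- r) y d;
  dg_indep : forall (r : seq int) (y : int -> dg_sort), uniq r ->
    (forall d, dg_homog d (y d)) -> \sum_(d <- r) y d = 0 ->
    forall d, d \in r -> y d = 0;
  dg_diff_homog : forall d x, dg_homog d x -> dg_homog (d + 1) (dg_diff x);
  dg_diffK : forall x, dg_diff (dg_diff x) = 0;
  dg_leibniz : forall d x y, dg_homog d x ->
    dg_diff (x * y) = dg_diff x * y + (-1 : F) ^ d *: (x * dg_diff y)
}.

Section Cohomology.
Variables (F : fieldType) (C : dgAlgebra F).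
Implicit Types (d e : int) (x y : C).

Lemma dg_homogN d x : dg_homog d x -> dg_homog d (- x).
Proof.
by move=> hx; rewrite -scaleN1r -[_ *: _]addr0; apply: dg_homogP hx (dg_homog0 C d).
Qed.

Lemma dg_homogB d x y : dg_homog d x -> dg_homog d y -> dg_homog d (x - y).
Proof. by move=> hx hy; rewrite -[x]scale1r; apply/dg_homogP/dg_homogN. Qed.

Lemma dg_homogZ d c x : dg_homog d x -> dg_homog d (c *: x).
Proof. by move=> hx; rewrite -[_ *: _]addr0; apply: dg_homogP hx (dg_homog0 C d). Qed.

Definition cocycle_pred d : {pred C} :=
  [pred x | `[< dg_homog d x /\ dg_diff C x = 0 >]].

Lemma cocycle_zmod_closed d : zmod_closed (cocycle_pred d).
Proof.
split; first by apply/asboolP; split; [exact: dg_homog0 | exact: raddf0].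
move=> x y /asboolP[hx dx] /asboolP[hy dy]; apply/asboolP; split.
  exact: dg_homogB.
by rewrite raddfB /= dx dy subrr.
Qed.

HB.instance Definition _ d :=
  GRing.isZmodClosed.Build C (cocycle_pred d) (cocycle_zmod_closed d).

Record cocycle d := Cocycle { cocycle_val :> C; _ : cocycle_val \in cocycle_pred d }.

HB.instance Definition _ d := [isSub for @cocycle_val d].
HB.instance Definition _ d := [Choice of cocycle d by <:].
HB.instance Definition _ d := [SubChoice_isSubZmodule of cocycle d by <:].

Definition coboundary d : {pred cocycle d} :=
  [pred z | `[< exists2 y : C, dg_homog (d - 1) y & dg_diff C y = val z >]].

Lemma coboundary_zmod_closed d : zmod_closed (@coboundary d).
Proof.
split; first by apply/asboolP; exists 0; [exact: dg_homog0 | rewrite raddf0].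
move=> z w /asboolP[x hx dx] /asboolP[y hy dy]; apply/asboolP.
by exists (x - y); [exact: dg_homogB | rewrite !raddfB /= dx dy].
Qed.

HB.instance Definition _ d :=
  GRing.isZmodClosed.Build (cocycle d) (@coboundary d) (@coboundary_zmod_closed d).

(** [H^d], the quotient of the [d]-cocycles by the [d]-coboundaries. *)
Definition cohom d := Quotient.quot (@coboundary d).

HB.instance Definition _ d := GRing.Zmodule.on (cohom d).

Definition represents d (c : cohom d) x : Prop :=
  exists z : cocycle d, val z = x /\ c = \pi_(cohom d) z.

Lemma cocycle_mul_subproof d e (z : cocycle d) (w : cocycle e) :
  val z * val w \in cocycle_pred (d + e).
Proof.
have /asboolP[hz dz] := valP z; have /asboolP[hw dw] := valP w.
apply/asboolP; split; first exact: dg_homogM.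
by rewrite (dg_leibniz _ hz) dz dw mul0r mulr0 scaler0 addr0.
Qed.

Definition cocycle_mul d e (z : cocycle d) (w : cocycle e) : cocycle (d + e) :=
  Cocycle (cocycle_mul_subproof z w).

(** The choice of representatives is immaterial, see [pi_cup]. *)
Definition cup d e (a : cohom d) (b : cohom e) : cohom (d + e) :=
  \pi_(cohom (d + e)) (cocycle_mul (repr a) (repr b)).

Lemma pi_cup d e (z : cocycle d) (w : cocycle e) :
  cup (\pi_(cohom d) z) (\pi_(cohom e) w) =
  \pi_(cohom (d + e)) (cocycle_mul z w).
Proof.
rewrite /cup; case: piP => z' /eqP; case: piP => w' /eqP.
rewrite -!Quotient.idealrBE => /asboolP[y hy dy] /asboolP[x hx dx].
apply/eqP; rewrite eq_sym -Quotient.idealrBE; apply/asboolP.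
have /asboolP[hz' dz'] := valP z'; have /asboolP[hw dw] := valP w.
exists (x * val w + (-1) ^ d *: (val z' * y)).
  have hxw : dg_homog (d + e - 1) (x * val w) by rewrite addrAC; apply: dg_homogM.
  have hzy : dg_homog (d + e - 1) (val z' * y) by rewrite -addrA; apply: dg_homogM.
  by rewrite [x * _ + _]addrC; apply: dg_homogP.
rewrite raddfD /= linearZ /= (dg_leibniz _ hx) (dg_leibniz _ hz') dw dz'.
rewrite mulr0 scaler0 addr0 mul0r add0r scalerA -expfzMl mulrNN mulr1 exp1rz.
rewrite scale1r dx dy !raddfB /= mulrBl mulrBr.
by rewrite addrA subrK.
Qed.

End Cohomology.

(** The classes [a i] in degrees [d i] matter for [1 <= i <= n] only, and
    the elements [A i j] of a defining system only for [1 <= i < j <= n + 1]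
    and [(i, j) <> (1, n + 1)]. *)
Section Massey.
Variables (F : fieldType) (C : dgAlgebra F) (n : nat).
Variables (d : nat -> int) (a : forall i, cohom C (d i)).

Definition massey_deg (i j : nat) : int :=
  \sum_(i <= s < j) d s - (j%:Z - 1 - i%:Z).

Definition massey_bar (e : int) (x : C) : C := (-1 : F) ^ (1 + e) *: x.

Definition defining_index (i j : nat) : Prop :=
  [/\ (1 <= i)%N, (i < j)%N, (j <= n.+1)%N & (i, j) <> (1, n.+1)%N].

Record defining_system (A : nat -> nat -> C) : Prop := DefiningSystem {
  ds_homog : forall i j, defining_index i j ->
    dg_homog (massey_deg i j) (A i j);
  ds_diff : forall i j, defining_index i j ->
    dg_diff C (A i j) =
      \sum_(i.+1 <= k < j) massey_bar (massey_deg i k) (A i k) * A k j;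
  ds_represents : forall i, (1 <= i <= n)%N -> represents (a i) (A i i.+1)
}.

Definition massey_value (A : nat -> nat -> C) : C :=
  \sum_(2 <= k < n.+1) massey_bar (massey_deg 1 k) (A 1%N k) * A k n.+1.

Definition massey_product : set (cohom C (\sum_(1 <= s < n.+1) d s - n%:Z + 2)) :=
  [set c | exists2 A, defining_system A & represents c (massey_value A)].

Definition massey_vanishes : Prop := massey_product 0.

End Massey.

Definition strong_massey_vanishing (F : fieldType) (C : dgAlgebra F) : Prop :=
  forall (n : nat) (d : nat -> int) (a : forall i, cohom C (d i)),
    (2 <= n)%N ->
    (forall i, (1 <= i < n)%N -> cup (a i) (a i.+1) = 0) ->
    massey_vanishes n a.

(** Inhomogeneous cochains with trivial action on the coefficients. An element
    of the direct sum of the groups [C^n(G, F)], [n >= 0], is encoded as a single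
    function on [seq G], the disjoint union of the powers [G^n]; the component
    of degree [n] is its restriction to the sequences of size [n]. *)
Section Cochains.
Variables (G : topologicalGroupType) (F : fieldType).
Implicit Types (s : seq G) (f g h : seq G -> F^o).

Definition continuous_in_degree f (n : nat) : Prop :=
  continuous
    ((fun x => f (codom x)) : {ptws 'I_n -> G} -> discrete_topology F).

Definition cochain_pred : {pred seq G -> F^o} :=
  [pred f | `[< (exists N, forall s, (N < size s)%N -> f s = 0) /\
                (forall n, continuous_in_degree f n) >]].

(** For [s = (g_1, ..., g_n)] and [n >= 1]: [face 0 s = (g_2, ..., g_n)],
    [face i s = (g_1, ..., g_i g_(i+1), ..., g_n)] for [0 < i < n], and
    [face n s = (g_1, ..., g_(n-1))]. *)
Definition face (i : nat) s : seq G :=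
  if i == 0%N then behead s else
  take i.-1 s ++
    (if (i < size s)%N then (nth 1 s i.-1 * nth 1 s i)%g :: drop i.+1 s
     else [::]).

Definition cochain_diff_fun f s : F :=
  if nilp s then 0 else \sum_(i < (size s).+1) (-1) ^+ i * f (face i s).

Definition cochain_cup_fun f g s : F :=
  \sum_(i < (size s).+1) f (take i s) * g (drop i s).

Definition cochain_one_fun s : F := (nilp s)%:R.

#[local] Instance ptws_filter n (x : {ptws 'I_n -> G}) : ProperFilter (nbhs x) :=
  @nbhs_pfilter {ptws 'I_n -> G} x.

Lemma ptws_nearW n (x : {ptws 'I_n -> G}) (P : {ptws 'I_n -> G} -> Prop) :
  (forall y, P y) -> \forall y \near x, P y.
Proof. by move=> Py; exact: (@nearW _ (nbhs x) P (ptws_filter x) Py). Qed.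

Lemma continuous_in_degreeP f n :
  continuous_in_degree f n <->
  forall x : {ptws 'I_n -> G}, \forall y \near x, f (codom y) = f (codom x).
Proof.
split=> fc x.
  exact: (fc x _ (@discrete_set1 (discrete_topology F) (f (codom x)))).
move=> A nA; apply: filterS (fc x) => y /= ->.
exact: (nbhs_singleton nA).
Qed.

Lemma nth_codom_continuous n k :
  continuous ((fun x => nth 1%g (codom x) k) : {ptws 'I_n -> G} -> G).
Proof.
case: (ltnP k n) => [kn|nk] x.
  have E : (fun x : {ptws 'I_n -> G} => nth 1%g (codom x) k) = proj (Ordinal kn).
    apply/funext=> y; rewrite (nth_map (Ordinal kn)) ?size_enum_ord //.
    by congr y; apply: val_inj; rewrite /= nth_enum_ord.
  by rewrite E; exact: (@proj_continuous 'I_n (fun=> G) (Ordinal kn) x).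
have E : (fun x : {ptws 'I_n -> G} => nth 1%g (codom x) k) = cst 1%g.
  by apply/funext=> y; rewrite nth_default // size_codom card_ord.
by rewrite E; exact: cst_continuous.
Qed.

Lemma near_eq_comp f m n (hs : {ptws 'I_m -> G} -> seq G) :
  continuous_in_degree f n -> (forall x, size (hs x) = n) ->
  (forall k, continuous (fun x => nth 1%g (hs x) k)) ->
  forall x, \forall y \near x, f (hs y) = f (hs x).
Proof.
move=> /continuous_in_degreeP fc hsz hc x.
pose t (y : {ptws 'I_m -> G}) : {ptws 'I_n -> G} := fun i => nth 1%g (hs y) i.
have tE y : codom (t y) = hs y.
  apply: (@eq_from_nth _ 1%g); first by rewrite size_codom card_ord hsz.
  move=> i; rewrite size_codom card_ord => ltin.
  rewrite (nth_map (Ordinal ltin)) ?size_enum_ord // /t.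
  by congr nth; rewrite /= nth_enum_ord.
have tc : continuous t.
  move=> {}x; apply/cvg_sup => i.
  move: x; apply/(@continuousP _ (initial_topology (@^~ i))) => A [B ? <-].
  have ci : continuous (fun y => t y i) by exact: hc.
  by move/continuousP : ci; apply.
have : \forall y \near x, f (codom (t y)) = f (codom (t x)) := tc x _ (fc (t x)).
by apply: filterS => y; rewrite !tE.
Qed.

Lemma cochainP f :
  reflect ((exists N, forall s, (N < size s)%N -> f s = 0) /\
           (forall n, continuous_in_degree f n)) (f \in cochain_pred).
Proof. exact: asboolP. Qed.

Lemma near_eq_sum (T : topologicalType) (I : Type) (r : seq I) (u : I -> T -> F) x :
  (forall i, \forall y \near x, u i y = u i x) ->
  \forall y \near x, \sum_(i <- r) u i y = \sum_(i <- r) u i x.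
Proof.
move=> uc; elim: r => [|i r IH]; first by apply: nearW => y; rewrite !big_nil.
by near=> y; rewrite !big_cons; congr (_ + _); near: y; [exact: uc | exact: IH].
Unshelve. all: by end_near. Qed.

Lemma cochain_submod_closed : submod_closed cochain_pred.
Proof.
split; first by apply/cochainP; split=> [|n]; [exists 0%N | exact: cst_continuous].
move=> c f g /cochainP[[N fN] fc] /cochainP[[M gM] gc]; apply/cochainP; split.
  exists (N + M)%N => s ltNMs.
  have -> : (c *: f + g) s = c *: f s + g s by [].
  rewrite fN ?gM ?scaler0 ?addr0 //.
    by rewrite (leq_ltn_trans _ ltNMs) ?leq_addl.
  by rewrite (leq_ltn_trans _ ltNMs) ?leq_addr.
move=> n; apply/continuous_in_degreeP => x.
have /continuous_in_degreeP/(_ x) fx := fc n.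
have /continuous_in_degreeP/(_ x) gx := gc n.
near=> y; congr (c *: (_ : F^o) + _); near: y; [exact: fx | exact: gx].
Unshelve. all: by end_near. Qed.

HB.instance Definition _ :=
  GRing.isSubmodClosed.Build F (seq G -> F^o) cochain_pred cochain_submod_closed.

Lemma nth_take_continuous n m k :
  continuous ((fun x => nth 1%g (take m (codom x)) k) : {ptws 'I_n -> G} -> G).
Proof.
case: (ltnP k m) => [km|mk].
  have -> : (fun x : {ptws 'I_n -> G} => nth 1%g (take m (codom x)) k) =
            (fun x => nth 1%g (codom x) k).
    by apply/funext => x; rewrite nth_take.
  exact: nth_codom_continuous.
have -> : (fun x : {ptws 'I_n -> G} => nth 1%g (take m (codom x)) k) = cst 1%g.
  by apply/funext=> y; rewrite nth_default // size_take_min geq_min mk.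
exact: cst_continuous.
Qed.

Lemma nth_drop_continuous n m k :
  continuous ((fun x => nth 1%g (drop m (codom x)) k) : {ptws 'I_n -> G} -> G).
Proof.
have -> : (fun x : {ptws 'I_n -> G} => nth 1%g (drop m (codom x)) k) =
          (fun x => nth 1%g (codom x) (m + k)).
  by apply/funext => x; rewrite nth_drop.
exact: nth_codom_continuous.
Qed.

Lemma size_face i s : (i <= size s)%N -> size (face i s) = (size s).-1.
Proof.
rewrite /face; case: i => [|i] /= lis; first by rewrite size_behead.
rewrite size_cat size_takel; last exact: ltnW.
case: (ltnP i.+1 (size s)) => [lt|ge] /=; last by rewrite addn0; lia.
rewrite size_drop; lia.
Qed.

Lemma face0 x s : face 0 (x :: s) = s.
Proof. by []. Qed.

Lemma face1 x : face 1 [:: x] = [::].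
Proof. by []. Qed.

Lemma face1_cons x y s : face 1 [:: x, y & s] = (x * y)%g :: s.
Proof. by rewrite /face /= drop0. Qed.

Lemma face_cons i x s : face i.+2 (x :: s) = x :: face i.+1 s.
Proof. by []. Qed.

Lemma nth_face_continuous n i k : (i <= n)%N ->
  continuous ((fun x => nth 1%g (face i (codom x)) k) : {ptws 'I_n -> G} -> G).
Proof.
case: i => [|i] lin.
  rewrite (_ : (fun x : {ptws 'I_n -> G} => _) = (fun x => nth 1%g (codom x) k.+1)).
    exact: nth_codom_continuous.
  by apply/funext=> x; rewrite /face /= nth_behead.
rewrite /face /=.
have sz (x : {ptws 'I_n -> G}) : size (codom x) = n by rewrite size_codom card_ord.
have szt (x : {ptws 'I_n -> G}) : size (take i (codom x)) = i.
  by rewrite size_takel // sz ltnW.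
case: (ltngtP k i) => [ki|ik|ki].
- rewrite (_ : (fun x : {ptws 'I_n -> G} => _) = (fun x => nth 1%g (codom x) k)).
    exact: nth_codom_continuous.
  by apply/funext=> x; rewrite nth_cat szt ?sz ki nth_take.
- case: (ltnP i.+1 n) => iltn.
    rewrite (_ : (fun x : {ptws 'I_n -> G} => _) = (fun x => nth 1%g (codom x) k.+1)).
      exact: nth_codom_continuous.
    apply/funext=> x; rewrite nth_cat szt ?sz ltnNge (ltnW ik) /=.
    rewrite iltn -(subnSK ik) /= nth_drop; congr nth; lia.
  rewrite (_ : (fun x : {ptws 'I_n -> G} => _) = cst 1%g).
    exact: cst_continuous.
  apply/funext=> x; rewrite sz ltnNge iltn /= cats0 nth_default // szt; exact: ltnW.
- subst k; case: (ltnP i.+1 n) => iltn.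
    rewrite (_ : (fun x : {ptws 'I_n -> G} => _) =
                 (fun x => (nth 1 (codom x) i * nth 1 (codom x) i.+1)%g)).
      move=> x; apply: (@continuous_comp _ _ _
        (fun x : {ptws 'I_n -> G} => (nth 1%g (codom x) i, nth 1%g (codom x) i.+1))
        (fun x : G * G => (x.1 * x.2)%g)); last exact: mulg_continuous.
      by apply: cvg_pair; exact: nth_codom_continuous.
    by apply/funext=> x; rewrite nth_cat szt ?sz ltnn subnn iltn.
  rewrite (_ : (fun x : {ptws 'I_n -> G} => _) = cst 1%g).
    exact: cst_continuous.
  by apply/funext=> x; rewrite sz ltnNge iltn /= cats0 nth_default // szt.
Qed.

Lemma cochain_diff_subproof f :
  f \in cochain_pred -> (cochain_diff_fun f : seq G -> F^o) \in cochain_pred.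
Proof.
move=> /cochainP[[N fN] fc]; apply/cochainP; split.
  exists N.+1 => s ltNs; rewrite /cochain_diff_fun.
  case: ifP => // _; apply: big1 => i _.
  have lei : (i <= size s)%N by rewrite -ltnS.
  by rewrite fN ?mulr0 // size_face //; lia.
move=> [|n]; apply/continuous_in_degreeP => x.
  apply: ptws_nearW => y; rewrite /cochain_diff_fun.
  by rewrite /nilp !size_codom card_ord.
pose u (i : 'I_n.+2) (y : {ptws 'I_n.+1 -> G}) : F := (-1) ^+ i * f (face i (codom y)).
suff H : \forall y \near x, \sum_i u i y = \sum_i u i x.
  apply: filterS H => y; rewrite /cochain_diff_fun /nilp !size_codom.
  by rewrite card_ord.
apply: near_eq_sum => i.
have lei : (i <= n.+1)%N by rewrite -ltnS.
near=> y; congr (_ * _); near: y.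
apply: (near_eq_comp (n := n)) => // [z|k].
  by rewrite size_face size_codom card_ord.
exact: nth_face_continuous.
Unshelve. all: by end_near. Qed.

Lemma cochain_cup_subproof f g :
  f \in cochain_pred -> g \in cochain_pred ->
  (cochain_cup_fun f g : seq G -> F^o) \in cochain_pred.
Proof.
move=> /cochainP[[N fN] fc] /cochainP[[M gM] gc]; apply/cochainP; split.
  exists (N + M)%N => s lts; apply: big1 => i _.
  have lei : (i <= size s)%N by rewrite -ltnS.
  case: (ltnP N i) => Ni; first by rewrite fN ?mul0r // size_takel.
  by rewrite gM ?mulr0 // size_drop; lia.
move=> n; apply/continuous_in_degreeP => x.
pose u (i : 'I_n.+1) (y : {ptws 'I_n -> G}) : F :=
  f (take i (codom y)) * g (drop i (codom y)).
suff H : \forall y \near x, \sum_i u i y = \sum_i u i x.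
  by apply: filterS H => y; rewrite /cochain_cup_fun !size_codom card_ord.
apply: near_eq_sum => i.
have lei : (i <= n)%N by rewrite -ltnS.
near=> y; congr (_ * _); near: y.
- apply: (near_eq_comp (n := i)) => // [z|k].
    by rewrite size_takel // size_codom card_ord.
  exact: nth_take_continuous.
- apply: (near_eq_comp (n := (n - i)%N)) => // [z|k].
    by rewrite size_drop size_codom card_ord.
  exact: nth_drop_continuous.
Unshelve. all: by end_near. Qed.

Lemma cochain_one_subproof : (cochain_one_fun : seq G -> F^o) \in cochain_pred.
Proof.
apply/cochainP; split; first by exists 0%N => -[].
move=> n; apply/continuous_in_degreeP => x; apply: ptws_nearW => y.
by rewrite /cochain_one_fun /nilp !size_codom.
Qed.

Record cochain := Cochain {
  cochain_fun :> seq G -> F^o;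
  cochain_fun_subproof : cochain_fun \in cochain_pred
}.

HB.instance Definition _ := [isSub for cochain_fun].
HB.instance Definition _ := [Choice of cochain by <:].
HB.instance Definition _ := [SubChoice_isSubLmodule of cochain by <:].

Definition cochain_diff (f : cochain) : cochain :=
  Cochain (cochain_diff_subproof (valP f)).

Definition cochain_cup (f g : cochain) : cochain :=
  Cochain (cochain_cup_subproof (valP f) (valP g)).

Definition cochain_one : cochain := Cochain cochain_one_subproof.

Definition cochain_homog (d : int) : set cochain :=
  [set f | forall s, (size s)%:Z != d -> f s = 0].

Lemma cochainE (f g : cochain) : (forall s, f s = g s) -> f = g.
Proof. by move=> fg; apply: val_inj; apply/funext. Qed.

Lemma cochain_linE (c : F) (f g : cochain) s : (c *: f + g) s = c * f s + g s.
Proof. by []. Qed.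

Lemma cochain_addE (f g : cochain) s : (f + g) s = f s + g s.
Proof. by []. Qed.

Lemma cochain_scaleE c (f : cochain) s : (c *: f) s = c * f s.
Proof. by []. Qed.

Lemma cochain_sumE (I : Type) (r : seq I) (u : I -> cochain) s :
  (\sum_(i <- r) u i) s = \sum_(i <- r) u i s.
Proof. by elim/big_rec2: _ => // i x y _ <-. Qed.

Lemma cup_nil f g : cochain_cup_fun f g [::] = f [::] * g [::].
Proof. by rewrite /cochain_cup_fun big_ord_recl big_ord0 addr0. Qed.

Lemma cup_cons f g x s : cochain_cup_fun f g (x :: s) =
  f [::] * g (x :: s) + cochain_cup_fun (fun t => f (x :: t)) g s.
Proof. by rewrite /cochain_cup_fun big_ord_recl. Qed.

Lemma cup_linl (c : F) f g h s :
  cochain_cup_fun (fun t => c * f t + g t) h s =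
  c * cochain_cup_fun f h s + cochain_cup_fun g h s.
Proof.
rewrite /cochain_cup_fun mulr_sumr -big_split /=; apply: eq_bigr => i _.
by rewrite mulrDl mulrA.
Qed.

Lemma cup_linr (c : F) f g h s :
  cochain_cup_fun f (fun t => c * g t + h t) s =
  c * cochain_cup_fun f g s + cochain_cup_fun f h s.
Proof.
rewrite /cochain_cup_fun mulr_sumr -big_split /=; apply: eq_bigr => i _.
by rewrite mulrDr mulrCA.
Qed.

Lemma cup_assoc f g h s :
  cochain_cup_fun f (cochain_cup_fun g h) s =
  cochain_cup_fun (cochain_cup_fun f g) h s.
Proof.
elim: s f g h => [|x s IH] f g h; first by rewrite !cup_nil mulrA.
rewrite !cup_cons IH cup_nil.
rewrite (_ : (fun t => cochain_cup_fun f g (x :: t)) =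
  (fun t => f [::] * g (x :: t) + cochain_cup_fun (fun t => f (x :: t)) g t)).
  by rewrite cup_linl mulrDr mulrA addrA.
by apply/funext => t; rewrite cup_cons.
Qed.

Lemma cochain_mulA : associative cochain_cup.
Proof. by move=> f g h; apply: cochainE => s; exact: cup_assoc. Qed.

Lemma cochain_mul1r : left_id cochain_one cochain_cup.
Proof.
move=> f; apply: cochainE => s; rewrite /= /cochain_cup_fun big_ord_recl.
rewrite take0 drop0 /cochain_one_fun mul1r big1 ?addr0 // => i _.
by case: s i => [|x s] [i lti] //=; rewrite mul0r.
Qed.

Lemma cochain_mulr1 : right_id cochain_one cochain_cup.
Proof.
move=> f; apply: cochainE => s; rewrite /= /cochain_cup_fun big_ord_recr /=.
rewrite take_size drop_size /cochain_one_fun mulr1 big1 ?add0r // => i _.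
by rewrite /nilp size_drop subn_eq0 leqNgt ltn_ord mulr0.
Qed.

Lemma cochain_mulDl : left_distributive cochain_cup +%R.
Proof.
move=> f g h; apply: cochainE => s.
rewrite cochain_addE /= -[cochain_cup_fun f h s]mul1r -cup_linl.
by congr cochain_cup_fun; apply/funext => t; rewrite mul1r.
Qed.

Lemma cochain_mulDr : right_distributive cochain_cup +%R.
Proof.
move=> f g h; apply: cochainE => s.
rewrite cochain_addE /= -[cochain_cup_fun f g s]mul1r -cup_linr.
by congr cochain_cup_fun; apply/funext => t; rewrite mul1r.
Qed.

Lemma cochain_one_neq0 : cochain_one != 0.
Proof.
apply/eqP => /(congr1 (fun f : cochain => f [::])) /eqP.
by rewrite /= /cochain_one_fun oner_eq0.
Qed.

HB.instance Definition _ := GRing.Zmodule_isNzRing.Build cochain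
  cochain_mulA cochain_mul1r cochain_mulr1 cochain_mulDl cochain_mulDr
  cochain_one_neq0.

Lemma cochain_scaleAl (c : F) (f g : cochain) : c *: (f * g) = c *: f * g.
Proof.
apply: cochainE => s; rewrite cochain_scaleE /= /cochain_cup_fun mulr_sumr.
by apply: eq_bigr => i _; rewrite mulrA.
Qed.

HB.instance Definition _ := GRing.Lmodule_isLalgebra.Build F cochain cochain_scaleAl.

Lemma cochain_scaleAr (c : F) (f g : cochain) : c *: (f * g) = f * (c *: g).
Proof.
apply: cochainE => s; rewrite cochain_scaleE /= /cochain_cup_fun mulr_sumr.
by apply: eq_bigr => i _; rewrite mulrCA.
Qed.

HB.instance Definition _ := GRing.Lalgebra_isAlgebra.Build F cochain cochain_scaleAr.

Lemma cochain_mulE (f g : cochain) s : (f * g) s = cochain_cup_fun f g s.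
Proof. by []. Qed.

Lemma cochain_diff_linear : linear cochain_diff.
Proof.
move=> c f g; apply: cochainE => s; rewrite cochain_linE /= /cochain_diff_fun.
case: ifP => _; first by rewrite mulr0 addr0.
rewrite mulr_sumr -big_split /=; apply: eq_bigr => i _.
by rewrite mulrDr mulrCA.
Qed.

HB.instance Definition _ :=
  GRing.isLinear.Build F cochain cochain *:%R cochain_diff cochain_diff_linear.

Lemma face_face i j s : (i < j)%N -> (j <= size s)%N ->
  face i (face j s) = face j.-1 (face i s).
Proof.
elim: s i j => [|x s IH] i [|j] //= ltij.
case: s IH => [|y s] IH /=; rewrite ltnS.
  by case: j ltij => //; case: i.
move=> lejs; case: i ltij => [|i] ltij.
  by case: j {ltij lejs} => [|j]; rewrite ?face1_cons ?face_cons.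
case: j ltij lejs => [|j] // ltij lejs.
rewrite face_cons; case: i ltij => [|i] ltij; last first.
  by case: j ltij lejs => [|j] // ltij lejs; rewrite ![face _ (x :: _)]face_cons (IH i.+1 j.+2).
rewrite face1_cons; case: j ltij lejs => [|j] _ lejs.
  case: s {IH} lejs => [|z s] lejs; first by rewrite !face1.
  by rewrite !face1_cons mulgA.
by rewrite !face_cons face1_cons.
Qed.

Lemma alternating_sum0 (u : nat -> nat -> F) n :
  (forall i j, (i < j <= n)%N -> u i j = u j.-1 i) ->
  \sum_(j < n.+1) \sum_(i < n) (-1) ^+ (i + j) * u i j = 0.
Proof.
elim: n => [|n IH] hu.
  by rewrite big1 // => j _; rewrite big_ord0.
rewrite big_ord_recr /=.
under eq_bigr do rewrite big_ord_recr /=.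
rewrite big_split /= IH ?add0r => [|i j /andP[ij jn]]; last first.
  by rewrite hu // ij ltnW.
rewrite -big_split /=; apply: big1 => i _.
rewrite (hu i n.+1) ?ltn_ord ?leqnn //= addnS addnC exprS mulN1r mulNr.
exact: subrr.
Qed.

Lemma cochain_diffK f s : cochain_diff_fun (cochain_diff_fun f) s = 0.
Proof.
rewrite {1}/cochain_diff_fun; case: ifPn => // s0.
have [m sm] : exists m, size s = m.+1 by case: (s) s0 => // x t _; exists (size t).
rewrite sm; case: m sm => [|m] sm.
  apply: big1 => i _; rewrite /cochain_diff_fun /nilp size_face ?sm ?mulr0 //.
  by rewrite -ltnS.
rewrite -[RHS](@alternating_sum0 (fun i j => f (face i (face j s))) m.+2).
  apply: eq_bigr => j _.
  have sf : size (face j s) = m.+1 by rewrite size_face ?sm // -ltnS.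
  rewrite /cochain_diff_fun /nilp sf /= mulr_sumr; apply: eq_bigr => i _.
  by rewrite mulrA -exprD addnC.
by move=> i j /andP[ij jm]; rewrite face_face // sm.
Qed.

Lemma face_nil i : face i [::] = [::].
Proof. by case: i. Qed.

Lemma take_face_le m i s : (i <= m)%N -> (m < size s)%N ->
  take m (face i s) = face i (take m.+1 s).
Proof.
elim: s m i => [|x s IH] m [|[|i]] //= lim; rewrite ltnS => ms.
  case: s m lim ms {IH} => [|y s] [|m] //= _ _.
  by rewrite face1_cons drop0.
by case: m lim ms => [|m] // lim ms; rewrite !face_cons /= IH.
Qed.

Lemma drop_face_le m i s : (i <= m)%N -> (m < size s)%N ->
  drop m (face i s) = drop m.+1 s.
Proof.
elim: s m i => [|x s IH] m [|[|i]] //= lim; rewrite ltnS => ms.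
  case: s m lim ms {IH} => [|y s] [|m] //= _ _.
  by rewrite drop0.
by case: m lim ms => [|m] // lim ms; rewrite face_cons /= IH.
Qed.

Lemma take_face_gt m j s : take m (face (m + j.+1) s) = take m s.
Proof.
elim: m s => [|m IH] [|x s]; rewrite ?take0 ?face_nil //.
by rewrite addSn addnS face_cons -addnS /= IH.
Qed.

Lemma drop_face_gt m j s : drop m (face (m + j.+1) s) = face j.+1 (drop m s).
Proof.
elim: m s => [|m IH] [|x s]; rewrite ?drop0 ?face_nil //.
by rewrite addSn addnS face_cons -addnS /= IH.
Qed.

Lemma face_last m s : size s = m.+1 -> face m.+1 s = take m s.
Proof. by move=> sm; rewrite /face /= sm ltnn cats0. Qed.

Lemma cup_homogE m f g s : (forall t, size t != m -> f t = 0) ->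
  cochain_cup_fun f g s =
  if (m <= size s)%N then f (take m s) * g (drop m s) else 0.
Proof.
move=> fm; rewrite /cochain_cup_fun; case: leqP => [ms|sm].
  rewrite (bigD1 (inord m : 'I_(size s).+1)) //= inordK // big1 ?addr0 // => i im.
  have lei : (i <= size s)%N by rewrite -ltnS.
  rewrite fm ?mul0r // size_takel //.
  by apply: contra im => /eqP <-; rewrite inord_val.
apply: big1 => i _; rewrite fm ?mul0r //.
have lei : (i <= size s)%N by rewrite -ltnS.
by rewrite size_takel // neq_ltn (leq_ltn_trans lei sm).
Qed.

Lemma diff_homogE m f : (forall t, size t != m -> f t = 0) ->
  forall t, size t != m.+1 -> cochain_diff_fun f t = 0.
Proof.
move=> fm t tm; rewrite /cochain_diff_fun; case: ifPn => // t0.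
apply: big1 => i _; have lei : (i <= size t)%N by rewrite -ltnS.
rewrite fm ?mulr0 // size_face //; apply: contra tm => /eqP <-.
by rewrite prednK // lt0n.
Qed.

Lemma cochain_leibniz_fun m f g s : (forall t, size t != m -> f t = 0) ->
  cochain_diff_fun (cochain_cup_fun f g) s =
  cochain_cup_fun (cochain_diff_fun f) g s +
  (-1) ^+ m * cochain_cup_fun f (cochain_diff_fun g) s.
Proof.
move=> fm; rewrite (cup_homogE _ _ (diff_homogE fm)) (cup_homogE _ _ fm).
rewrite {1}/cochain_diff_fun; case: (ltnP m (size s)) => [ms|sm]; last first.
  rewrite add0r (_ : (if _ then _ else _) = 0 :> F).
    case: ifP => [ms|]; last by rewrite mulr0.
    by rewrite {1}/cochain_diff_fun /nilp size_drop (eqP sm) !mulr0.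
  case: ifPn => // s0; apply: big1 => i _; have lei : (i <= size s)%N by rewrite -ltnS.
  rewrite (cup_homogE _ _ fm) size_face // leqNgt.
  by move: s0; rewrite /nilp -lt0n => s0; rewrite prednK // sm mulr0.
have [k sk] : exists k, size s = (m + k.+1)%N.
  by exists (size s - m.+1)%N; rewrite addnS -addSn subnKC.
have cupE (i : 'I_(m.+1 + k.+1)) : cochain_cup_fun f g (face i s) =
    f (take m (face i s)) * g (drop m (face i s)).
  have lei : (i <= size s)%N by rewrite sk -ltnS -addSn.
  by rewrite (cup_homogE _ _ fm) size_face // sk addnS /= leq_addr.
rewrite (ltnW ms) {1}/nilp sk addnS /= -addnS.
rewrite -[(m + k.+1).+1]addSn (eq_bigr _ (fun i _ => congr1 _ (cupE i))).
rewrite big_split_ord /= /cochain_diff_fun /nilp size_takel // size_drop sk addKn /=.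
rewrite [X in X * g _]big_ord_recr [X in _ * (_ * X)]big_ord_recl /=.
rewrite face_last ?size_takel // take_takel // expr0 mul1r.
have -> : face 0 (drop m s) = drop m.+1 s by rewrite /face /= -drop1 drop_drop.
rewrite mulrDl mulrDr mulrDr -addrA; congr (_ + _).
  rewrite mulr_suml; apply: eq_bigr => i _.
  by rewrite take_face_le -1?ltnS // drop_face_le -1?ltnS // mulrA.
rewrite exprS mulN1r !mulNr -mulrA addKr mulrA mulr_sumr.
apply: eq_bigr => i _; rewrite addSnnS take_face_gt drop_face_gt.
by rewrite exprD; ring.
Qed.

Lemma cochain_homog0 d : cochain_homog d 0.
Proof. by []. Qed.

Lemma cochain_homogP d (c : F) (f g : cochain) :
  cochain_homog d f -> cochain_homog d g -> cochain_homog d (c *: f + g).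
Proof. by move=> fd gd s sd; rewrite cochain_linE fd // gd // mulr0 addr0. Qed.

Lemma cochain_homog1 : cochain_homog 0 1.
Proof. by case. Qed.

Lemma cochain_homogM d e (f g : cochain) :
  cochain_homog d f -> cochain_homog e g -> cochain_homog (d + e) (f * g).
Proof.
move=> fd ge s sde; rewrite cochain_mulE; apply: big1 => i _.
have lei : (i <= size s)%N by rewrite -ltnS.
have [id|/fd->] := eqVneq (size (take i s))%:Z d; last by rewrite mul0r.
rewrite ge ?mulr0 //; apply: contra sde => /eqP <-; rewrite -id.
by rewrite -PoszD -size_cat cat_take_drop.
Qed.

Definition cochain_part_fun (d : int) f s : F :=
  if (size s)%:Z == d then f s else 0.

Lemma cochain_part_subproof d f :
  f \in cochain_pred -> (cochain_part_fun d f : seq G -> F^o) \in cochain_pred.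
Proof.
move=> /cochainP[[N fN] fc]; apply/cochainP; split.
  by exists N => s ltNs; rewrite /cochain_part_fun fN // if_same.
move=> n; apply/continuous_in_degreeP => x.
have /continuous_in_degreeP/(_ x) fx := fc n.
apply: filterS fx => y fy.
by rewrite /cochain_part_fun !size_codom fy.
Qed.

Definition cochain_part d (f : cochain) : cochain :=
  Cochain (cochain_part_subproof d (valP f)).

Lemma cochain_span (f : cochain) : exists (r : seq int) (y : int -> cochain),
  (forall d, cochain_homog d (y d)) /\ f = \sum_(d <- r) y d.
Proof.
have /cochainP[[N fN] _] := valP f.
exists [seq i%:Z | i <- iota 0 N.+1], (cochain_part^~ f); split.
  by move=> d s /negPf sd; rewrite /= /cochain_part_fun sd.
apply: cochainE => s; rewrite cochain_sumE big_map.
have [ltNs|lesN] := ltnP N (size s).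
  by rewrite big1 ?fN // => i _; rewrite /= /cochain_part_fun fN // if_same.
rewrite (bigD1_seq (size s)) ?iota_uniq ?mem_iota ?ltnS //.
rewrite big1 ?addr0 => [|i si]; rewrite /= /cochain_part_fun ?eqxx ?addr0 //.
by rewrite ifF //; apply: contraNF si => /eqP[->].
Qed.

Lemma cochain_indep (r : seq int) (y : int -> cochain) : uniq r ->
  (forall d, cochain_homog d (y d)) -> \sum_(d <- r) y d = 0 ->
  forall d, d \in r -> y d = 0.
Proof.
move=> ur yh y0 d dr; apply: cochainE => s.
have [sd|] := eqVneq (size s)%:Z d; last exact: yh.
have := congr1 (fun f : cochain => f s) y0.
rewrite /= cochain_sumE (bigD1_seq d) //= big1 ?addr0 // => e ed.
by apply: yh; rewrite sd eq_sym.
Qed.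

Lemma cochain_diff_homog d (f : cochain) :
  cochain_homog d f -> cochain_homog (d + 1) (cochain_diff f).
Proof.
move=> fd s sd; rewrite /= /cochain_diff_fun; case: ifPn => // s0.
apply: big1 => i _; have lei : (i <= size s)%N by rewrite -ltnS.
rewrite fd ?mulr0 // size_face //; apply: contra sd => /eqP <-.
by move: s0; rewrite /nilp -lt0n => s0; rewrite -PoszD addn1 prednK.
Qed.

Lemma cochain_diff_diff (f : cochain) : cochain_diff (cochain_diff f) = 0.
Proof. by apply: cochainE => s; exact: cochain_diffK. Qed.

Lemma cochain_leibniz d (f g : cochain) : cochain_homog d f ->
  cochain_diff (f * g) =
  cochain_diff f * g + (-1 : F) ^ d *: (f * cochain_diff g).
Proof.
case: d => m fm; last first.
  have -> : f = 0 by apply: cochainE => s; rewrite fm.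
  by rewrite !mul0r raddf0 mul0r scaler0 addr0.
by apply: cochainE => s; exact: cochain_leibniz_fun.
Qed.

Definition cochain_dga : dgAlgebra F :=
  @DGAlgebra F cochain cochain_homog cochain_diff
    cochain_homog0 cochain_homogP cochain_homog1 cochain_homogM
    cochain_span cochain_indep cochain_diff_homog cochain_diff_diff
    cochain_leibniz.

End Cochains.

(* Main.v *)
Require Import Defs.
From HB Require Import structures.
From mathcomp Require Import all_boot all_order all_fingroup all_algebra.
From mathcomp Require Import generic_quotient ring_quotient.
From mathcomp Require Import finmap all_classical topology.
From mathcomp Require Import ring zify.

(** Restricted to the subgroup generated by an involution [t], the statement is
    easy. Over a field of characteristic 2 the cohomology of that subgroup is a
    polynomial ring in one variable, the coefficient of a normalized cocycle
    being its value at [(t, ..., t)]; hence of two consecutive classes with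
    product zero one restricts to zero, and above the diagonal the defining
    system can be taken to vanish at [(t, ..., t)]. In the other characteristics
    there is nothing to control at [t].

    Real projectivity passes from these subgroups to [G] by a single embedding
    problem. The classes, and the cochains which bound the products of
    consecutive ones, are inflated from a finite quotient [H] of [G]
    ([descend_cochains]). Over [H] one builds a finite group [K] mapping onto
    [H], in which every involution of [H] lifts to an involution, and on which
    the inflated classes have a defining system together with a primitive of its
    Massey value ([finite_massey_system]). Lifting [G -> H] to [G -> K] is a real
    embedding problem ([real_projective_lift]), and pulling the system on [K]
    back to [G] proves the theorem.

    The group [K] is the top of a finite tower of extensions. The entries
    [A i j] are found by induction on [j - i], and each step kills an obstruction
    cocycle [b] of degree [k + 2 >= 2] ([trivialize_one]). To kill it, [b] is
    read as a factor set with values in the module [V] of normalized cochains of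
    degree [k] (dimension shifting). On the corresponding extension [bar_ext] of
    the group by [V], the projection to [V] is a primitive of [b]. An involution
    [t] lifts to an involution of the extension when [b(t, t, -)] is a norm from
    [V]. If 2 is invertible this always holds; in characteristic 2 the only
    obstruction is the value of [b] at [(t, ..., t)], and the lift can be chosen
    so that the primitive vanishes at its powers ([local_solution],
    [bar_ext_lift]). This vanishing is the induction hypothesis which makes the
    next obstructions vanish at the chosen involutions. Keeping track of finitely
    many chosen lifts, rather than of all involutions of [K], is what lets the
    tower be built without any compatibility with conjugation.

    Obstructions of degree at most 1 never have to be killed. A nonzero class of
    degree at most 0 is a nonzero constant, so that its neighbours are zero
    ([cup_eq0_degree_gt0]); and if the interval from [i] to [j] contains a zero
    class, represented by the zero cochain, then [A i j = 0] is a valid choice. *)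

Set Implicit Arguments.
Unset Strict Implicit.
Unset Printing Implicit Defensive.

Import Order.TTheory GRing.Theory Num.Theory.
Local Open Scope classical_set_scope.
Local Open Scope ring_scope.
Local Open Scope quotient_scope.

(** * The inhomogeneous bar differential by recursion on the first argument *)

Section BarRecursion.
Variables (G : groupType) (F : fieldType).
Implicit Types (f g : seq G -> F) (s : seq G) (x y z : G).

Definition slice f x : seq G -> F := fun s => f (x :: s).

(** The right action on the cochains of degree [k] for which a cochain of degree
    [k + 1], seen as a function of its first argument, is a cocycle exactly when
    it is a crossed homomorphism. *)
Fixpoint bar_act f z s : F :=
  if s is y :: s' then f ((z * y)%g :: s') - bar_act (slice f z) y s' else f [::].

Definition bar_diff f s : F := if s is x :: s' then f s' - bar_act f x s' else 0.

Definition normalized f := forall s, 1%g \in s -> f s = 0.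

Definition of_size k f := forall s, size s != k -> f s = 0.

Lemma eq_bar_act f g : f =1 g -> forall z, bar_act f z =1 bar_act g z.
Proof.
move=> fg z s; elim: s f g fg z => [|y s IH] f g fg z /=; first exact: fg.
by rewrite fg (IH _ (slice g z)) // => t; rewrite /slice fg.
Qed.

Lemma bar_act_lin (c : F) f g h z s : (forall t, h t = c * f t + g t) ->
  bar_act h z s = c * bar_act f z s + bar_act g z s.
Proof.
elim: s f g h z => [|y s IH] f g h z hE /=; first exact: hE.
rewrite hE (IH (slice f z) (slice g z)); last by move=> t; rewrite /slice hE.
by ring.
Qed.

Lemma bar_actB f g z s :
  bar_act (fun t => f t - g t) z s = bar_act f z s - bar_act g z s.
Proof.
rewrite (@bar_act_lin (-1) g f) => [|t]; first by ring.
by ring.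
Qed.

Lemma bar_actD f g z s :
  bar_act (fun t => f t + g t) z s = bar_act f z s + bar_act g z s.
Proof.
by rewrite (@bar_act_lin 1 f g) => [|t]; rewrite mul1r.
Qed.

Lemma bar_act0 f z s : (forall t, f t = 0) -> bar_act f z s = 0.
Proof.
by elim: s f z => [|y s IH] f z f0 /=; rewrite ?f0 // IH ?subr0 // => t; exact: f0.
Qed.

Lemma bar_actM f z z' s :
  bar_act (bar_act f z) z' s = bar_act f (z * z')%g s.
Proof.
elim: s f z z' => [|y s IH] f z z' //=.
have -> : bar_act (slice (bar_act f z) z') y s =
    bar_act (slice f (z * z')%g) y s - bar_act (bar_act (slice f z) z') y s.
  by rewrite -bar_actB.
by rewrite IH mulgA; ring.
Qed.

(** Without normalization the neutral element acts as an idempotent only, whose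
    image contains the normalized cochains. *)
Lemma bar_act1 f s : normalized f -> bar_act f 1%g s = f s.
Proof.
case: s => [|y s] fu //=; rewrite mul1g bar_act0 ?subr0 // => t.
by rewrite /slice fu // mem_head.
Qed.

Lemma normalized_slice f x : normalized f -> normalized (slice f x).
Proof. by move=> fu s s1; rewrite /slice fu // inE s1 orbT. Qed.

Lemma normalized_act f z : normalized f -> normalized (bar_act f z).
Proof.
move=> fu s; elim: s f fu z => [|y s IH] f fu z //=.
rewrite inE => /predU1P[<-|s1].
  by rewrite mulg1 (bar_act1 _ (normalized_slice z fu)) subrr.
by rewrite fu ?inE ?s1 ?orbT // IH ?subrr //; exact: normalized_slice.
Qed.

Lemma of_size_slice k f x : of_size k.+1 f -> of_size k (slice f x).
Proof. by move=> fk s sk; rewrite /slice fk. Qed.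

Lemma of_size_act k f z : of_size k f -> of_size k (bar_act f z).
Proof.
move=> fk s; elim: s k f fk z => [|y s IH] [|k] f fk z //= sk.
- by rewrite fk.
- rewrite fk // bar_act0 ?subr0 // => t; exact: fk.
- by rewrite fk // (IH k) ?subrr //; exact: of_size_slice.
Qed.

(** Evaluation at [(x_1 - 1, ..., x_n - 1)], extended multilinearly to the group
    ring. As [(x - 1) (y - 1) = (x y - 1) - (x - 1) - (y - 1)], this commutes
    with the differential. *)
Fixpoint normalize f s : F :=
  if s is x :: s' then normalize (fun t => f (x :: t) - f (1%g :: t)) s' else f [::].

(** A homotopy from [normalize] to the identity, see [normalize_htpyP]. Inserting
    [1] in front is a homotopy which normalizes the first argument; the recursion
    then treats the remaining ones. *)
Fixpoint normalize_htpy f s : F :=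
  f (1%g :: s) -
  (if s is x :: s' then normalize_htpy (fun t => f (x :: t) - f (1%g :: t)) s' else 0).

Lemma normalize_htpy_lin (c : F) f g h s : (forall t, h t = c * f t + g t) ->
  normalize_htpy h s = c * normalize_htpy f s + normalize_htpy g s.
Proof.
elim: s f g h => [|x s IH] f g h hE /=; first by rewrite hE; ring.
rewrite hE (IH (fun t => f (x :: t) - f (1%g :: t)) (fun t => g (x :: t) - g (1%g :: t))).
  by ring.
by move=> t; rewrite !hE; ring.
Qed.

Lemma eq_normalize_htpy f g : f =1 g -> normalize_htpy f =1 normalize_htpy g.
Proof.
move=> fg s; elim: s f g fg => [|x s IH] f g fg /=; rewrite fg //.
by congr (_ - _); apply: IH => t; rewrite !fg.
Qed.

Lemma normalize_htpyB f g s :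
  normalize_htpy (fun t => f t - g t) s = normalize_htpy f s - normalize_htpy g s.
Proof. by rewrite (@normalize_htpy_lin (-1) g f) => [|t]; ring. Qed.

Lemma normalize_eq0 f s : (forall t, f t = 0) -> normalize f s = 0.
Proof.
by elim: s f => [|x s IH] f f0 //=; apply: IH => t; rewrite !f0 subrr.
Qed.

Lemma normalize_htpy0 f s : (forall t, f t = 0) -> normalize_htpy f s = 0.
Proof.
by elim: s f => [|x s IH] f f0 /=; rewrite f0 ?IH ?subrr // => t; rewrite !f0 subrr.
Qed.

Lemma normalizeP f : normalized (normalize f).
Proof.
move=> s; elim: s f => [|x s IH] f //=; rewrite inE => /predU1P[<-|]; last exact: IH.
by apply: normalize_eq0 => t; rewrite subrr.
Qed.

Lemma normalize_id f s : normalized f -> normalize f s = f s.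
Proof.
elim: s f => [|x s IH] f fu //=.
have f1 t : f (1%g :: t) = 0 by rewrite fu // mem_head.
rewrite IH ?f1 ?subr0 // => t t1.
by rewrite f1 subr0 fu // inE t1 orbT.
Qed.

Lemma normalize_htpyD f g s :
  normalize_htpy (fun t => f t + g t) s = normalize_htpy f s + normalize_htpy g s.
Proof. by rewrite (@normalize_htpy_lin 1 f g) => [|t]; rewrite mul1r. Qed.

(** The induction goes through for arbitrary, not necessarily homogeneous,
    functions: the case of [x :: y :: s] only uses the identity for
    [f (x :: -) - f (1 :: -)] at [y :: s]. *)
Lemma normalize_htpyP f s :
  f s - normalize f s = bar_diff (normalize_htpy f) s + normalize_htpy (bar_diff f) s.
Proof.
elim: s f => [|x s IH] f /=; first by rewrite !subr0 subrr add0r.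
set h := fun t => f (x :: t) - f (1%g :: t).
have -> : f (x :: s) - normalize h s =
    f (1%g :: s) + (h s - normalize h s) by rewrite /h; ring.
rewrite {}IH; case: s => [|y s] /=.
  by rewrite /h /slice mul1g !mulg1; ring.
have -> : bar_act (slice (normalize_htpy f) x) y s =
    bar_act (fun t => f [:: 1%g, x & t]) y s - bar_act (normalize_htpy h) y s.
  by rewrite -bar_actB.
(* The homotopies of Q, on the right, and of P, on the left, are compared by
   linearity. *)
set Q := (X in _ + (_ - (_ - normalize_htpy X s))).
set P := (X in _ + (_ + (_ - normalize_htpy X s)) = _).
pose d z t := f (z :: t) - f (1%g :: t).
have PE t : Q t = (d y t - d (x * y)%g t) + (h t - P t).
  rewrite /Q /P /d /h !mulg1 !mul1g.
  have E z : bar_act (fun u => f (x :: u) - f (1%g :: u)) z t =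
      bar_act (slice f x) z t - bar_act (slice f 1%g) z t by rewrite bar_actB.
  by rewrite !E; ring.
rewrite (eq_normalize_htpy PE) (normalize_htpyD (fun t => d y t - d (x * y)%g t)).
rewrite (normalize_htpyB (d y)) (normalize_htpyB h) -/(d y) -/(d (x * y)%g).
have -> : bar_act (slice h 1%g) y s =
    bar_act (slice (slice f x) 1%g) y s - bar_act (slice (slice f 1%g) 1%g) y s.
  by rewrite -bar_actB.
by rewrite /slice /h !mulg1 !mul1g; ring.
Qed.

Lemma eq_bar_diff f g : f =1 g -> bar_diff f =1 bar_diff g.
Proof. by move=> fg [|x s] //=; rewrite fg (eq_bar_act fg). Qed.

Lemma bar_diffB f g s :
  bar_diff (fun t => f t - g t) s = bar_diff f s - bar_diff g s.
Proof. by case: s => [|x s] /=; rewrite ?subr0 // bar_actB; ring. Qed.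

Lemma bar_diffK f s : bar_diff (bar_diff f) s = 0.
Proof.
case: s => [|x [|y s]] //=; first by rewrite subrr.
have -> : bar_act (slice (bar_diff f) x) y s =
    bar_act f y s - bar_act (bar_act f x) y s by rewrite -bar_actB.
by rewrite bar_actM; ring.
Qed.

(** The homotopy formula shows that [normalize] is a chain map, and it fixes the
    normalized function [bar_diff f]. *)
Lemma bar_diff_normalize f : normalized (bar_diff f) ->
  bar_diff (normalize f) =1 bar_diff f.
Proof.
move=> dfu s; apply/eqP; rewrite -subr_eq0; apply/eqP.
have dE := normalize_htpyP (bar_diff f) s.
rewrite normalize_id // subrr in dE.
rewrite -opprB -bar_diffB (eq_bar_diff (normalize_htpyP f)).
have -> : bar_diff (fun t => bar_diff (normalize_htpy f) t + normalize_htpy (bar_diff f) t) s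
    = bar_diff (bar_diff (normalize_htpy f)) s + bar_diff (normalize_htpy (bar_diff f)) s.
  by case: (s) => [|x s'] /=; rewrite ?addr0 // bar_actD; ring.
rewrite bar_diffK add0r.
by rewrite (normalize_htpy0 _ (bar_diffK f)) addr0 in dE; rewrite -dE oppr0.
Qed.

Section CharTwo.
Hypothesis F2 : 2%:R = 0 :> F.
Variable t : G.
Hypothesis tt1 : (t * t)%g = 1%g.

Lemma char2_opp (c : F) : - c = c.
Proof. by apply/eqP; rewrite -subr_eq0 -opprD oppr_eq0 -mulr2n -mulr_natl F2 mul0r. Qed.

Lemma bar_act_nseq f n : normalized f -> bar_act f t (nseq n t) = f (nseq n t).
Proof.
elim: n f => [|n IH] f fu //=.
by rewrite tt1 fu ?mem_head // sub0r char2_opp IH //; exact: normalized_slice.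
Qed.

(** Evaluation at [(t, ..., t)] is well defined on cohomology: [f] may be replaced
    by the normalized function [normalize f], for which the inner faces of
    [(t, ..., t)] contain [t * t = 1] and the two outer ones cancel. *)
Lemma bar_diff_nseq f n : normalized (bar_diff f) -> bar_diff f (nseq n t) = 0.
Proof.
move=> dfu; rewrite -(bar_diff_normalize dfu); case: n => [|n] //=.
by rewrite bar_act_nseq ?subrr //; exact: normalizeP.
Qed.

(** The vanishing of a class in the Tate cohomology of the group generated by [t],
    with coefficients in the normalized cochains of degree [k]: an invariant [f]
    which vanishes at [(t, ..., t)] is a norm. The predicate [rho] singles out a
    representative of each orbit of left multiplication by [t]. Since a cochain is
    a function of its first argument, which ranges over free orbits, a solution may
    be prescribed to be 0 at the representatives; its value at [t] must then solve
    the problem for [f (t :: -)] in degree [k - 1]. In degree 0 the solution 0 is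
    taken, which is why [m] vanishes at [(t, ..., t)]. *)
Lemma local_solution (rho : pred G) k f :
    rho 1%g -> (forall w, rho (t * w)%g = ~~ rho w) ->
    normalized f -> of_size k f -> bar_act f t =1 f -> f (nseq k t) = 0 ->
  exists m, [/\ normalized m, of_size k m, forall s, m s + bar_act m t s = f s
    & m (nseq k t) = 0].
Proof.
move=> rho1 rhot; elim: k f => [|k IH] f fu fk ft f0.
  exists (fun=> 0); split=> // s; rewrite bar_act0 // addr0.
  by have [/size0nil->|/fk->] := eqVneq (size s) 0%N.
have f1 s : f (1%g :: s) = 0 by rewrite fu // mem_head.
have [||||c [cu ck ct c0]] := IH (slice f t).
- exact: normalized_slice.
- exact: of_size_slice.
- by move=> s; have := ft (t :: s); rewrite /= tt1 f1 sub0r char2_opp.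
- exact: f0.
(* [m (t :: -)] is the solution [c] obtained one degree lower *)
pose m s := if s is w :: s' then
  if rho w then 0 else slice f (t * w)%g s' + bar_act c (t * w)%g s' else 0.
have mt s : slice m t s = c s.
  by rewrite /slice /m -{1}[t]mulg1 rhot rho1 /= tt1 /slice f1 add0r bar_act1.
exists m; split.
- move=> [|w s] //; rewrite /m inE => /predU1P[<-|s1]; first by rewrite rho1.
  case: ifP => // _; rewrite /slice fu ?inE ?s1 ?orbT // add0r.
  exact: normalized_act.
- move=> [|w s] //; rewrite /m /= eqSS => sk; case: ifP => // _.
  by rewrite /slice fk ?eqSS // (of_size_act _ ck) // addr0.
- move=> [|w s]; first by rewrite /= addr0 fk.
  rewrite /= rhot mulgA tt1 mul1g (eq_bar_act mt).
  case: (rho w) => /=.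
    by rewrite add0r /slice; ring.
  have := ft (w :: s); rewrite /= => <-.
  rewrite -(bar_actM c t w s) (@eq_bar_act _ (fun s => slice f t s - c s)).
    rewrite bar_actB /slice sub0r (char2_opp (bar_act c w s)).
    by rewrite -!addrA -{2}(char2_opp (bar_act c w s)) subrr addr0 char2_opp.
  by move=> s'; rewrite -ct; ring.
- exact: etrans (mt _) c0.
Qed.

End CharTwo.

End BarRecursion.

Lemma bar_act_map (G K : groupType) (F : fieldType) (pi : G -> K)
    (f : seq K -> F) (z : G) (s : seq G) : {morph pi : x y / (x * y)%g} ->
  bar_act (fun t => f (map pi t)) z s = bar_act f (pi z) (map pi s).
Proof.
move=> piM; elim: s f z => [|y s IH] f z //=.
by rewrite piM -IH.
Qed.

Lemma bar_diff_map (G K : groupType) (F : fieldType) (pi : G -> K)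
    (f : seq K -> F) (s : seq G) : {morph pi : x y / (x * y)%g} ->
  bar_diff (fun t => f (map pi t)) s = bar_diff f (map pi s).
Proof. by case: s => [|x s] //= piM; rewrite bar_act_map. Qed.

(** * The extension of a finite group which kills a cocycle *)

Section NormalizedCochains.
Variables (K : finGroupType) (F : finFieldType) (k : nat).

Definition normalized_ffun (m : {ffun k.-tuple K -> F}) : bool :=
  [forall s : k.-tuple K, (1%g \in val s) ==> (m s == 0)].

(** Tuples and finite functions are used to obtain a finite type, hence a finite
    group [bar_ext]. *)
Definition ncochain : Type := {m : {ffun k.-tuple K -> F} | normalized_ffun m}.

HB.instance Definition _ := Finite.on ncochain.

Definition ncochain_fun (m : ncochain) (s : seq K) : F :=
  if insub s is Some t then sval m t else 0.
Coercion ncochain_fun : ncochain >-> Funclass.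

Lemma ncochain_of_subproof (f : seq K -> F) :
  normalized_ffun [ffun t : k.-tuple K => if 1%g \in val t then 0 else f t].
Proof. by apply/forallP => s; apply/implyP => s1; rewrite ffunE s1. Qed.

Definition ncochain_of f : ncochain :=
  exist (fun m => normalized_ffun m) _ (ncochain_of_subproof f).

Lemma ncochain_ofE f : normalized f -> of_size k f -> ncochain_of f =1 f.
Proof.
move=> fu fk s; rewrite /ncochain_fun; case: insubP => [t _ <-|/fk //].
by rewrite ffunE; case: ifP => // /fu.
Qed.

Lemma ncochain_normalized (m : ncochain) : normalized m.
Proof.
move=> s s1; rewrite /ncochain_fun; case: insubP => // t _ ts.
by apply/eqP; apply: implyP (forallP (svalP m) t) _; rewrite ts.
Qed.

Lemma ncochain_of_size (m : ncochain) : of_size k m.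
Proof. by move=> s; rewrite /ncochain_fun; case: insubP => // t ->. Qed.

Lemma ncochainP (m m' : ncochain) : m =1 m' -> m = m'.
Proof.
move=> mm'; apply/val_inj/ffunP => t; have := mm' t.
by rewrite /ncochain_fun valK.
Qed.

End NormalizedCochains.

Record ncocycle (K : finGroupType) (F : finFieldType) (k : nat) := NCocycle {
  ncocycle_fun :> seq K -> F;
  ncocycle_normalized : normalized ncocycle_fun;
  ncocycle_of_size : of_size k ncocycle_fun;
  ncocycle_closed : bar_diff ncocycle_fun =1 fun=> 0
}.

(** The parameter [b] determines the group law below. *)
Definition bar_ext (K : finGroupType) (F : finFieldType) (k : nat)
  (b : ncocycle K F k.+2) : Type := (ncochain K F k * K)%type.
HB.instance Definition _ K F k b := Finite.on (@bar_ext K F k b).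

Section BarExtension.
Variables (K : finGroupType) (F : finFieldType) (k : nat) (b : ncocycle K F k.+2).
Implicit Types (m : ncochain K F k) (x y z : K) (s : seq K).

Local Notation bar_ext := (bar_ext b).

Let beta x y s : F := b [:: x, y & s].

Let beta_normalized x y : normalized (beta x y).
Proof. by move=> s s1; apply: ncocycle_normalized; rewrite !inE s1 !orbT. Qed.

Let beta_size x y : of_size k (beta x y).
Proof. by move=> s sk; apply: ncocycle_of_size. Qed.

Let beta1x x s : beta 1%g x s = 0.
Proof. by apply: ncocycle_normalized; rewrite mem_head. Qed.

Let betax1 x s : beta x 1%g s = 0.
Proof. by apply: ncocycle_normalized; rewrite !inE eqxx orbT. Qed.

(** The factor set identity for [(x, y) |-> b (x, y, -)] is the cocycle identity
    of [b] at [(x, y, z, s)]. *)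
Let beta_cocycle x y z s :
  bar_act (beta x y) z s + beta (x * y)%g z s = beta y z s + beta x (y * z)%g s.
Proof.
have := ncocycle_closed b [:: x, y, z & s].
by rewrite /= /slice => /eqP; rewrite subr_eq0 => /eqP E; rewrite /beta E; ring.
Qed.

Definition bar_ext_mul (u v : bar_ext) : bar_ext :=
  (ncochain_of k (fun s => bar_act u.1 v.2 s + v.1 s - b [:: u.2, v.2 & s]),
   (u.2 * v.2)%g).

Definition bar_ext_one : bar_ext := (ncochain_of k (fun=> 0), 1%g).

Definition bar_ext_inv (u : bar_ext) : bar_ext :=
  (ncochain_of k
     (bar_act (fun s => b [:: (u.2^-1)%g, u.2 & s] - u.1 s) u.2^-1%g), u.2^-1%g).

Let mulE u v s : (bar_ext_mul u v).1 s =
  bar_act u.1 v.2 s + v.1 s - beta u.2 v.2 s.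
Proof.
apply: ncochain_ofE => t tP.
  rewrite (normalized_act _ (@ncochain_normalized _ _ _ u.1)) //.
  by rewrite ncochain_normalized // [b _]beta_normalized // addr0 subr0.
rewrite (of_size_act _ (@ncochain_of_size _ _ _ u.1)) //.
by rewrite ncochain_of_size // [b _]beta_size // addr0 subr0.
Qed.

Let oneE s : bar_ext_one.1 s = 0.
Proof. exact: ncochain_ofE. Qed.

Let invE u s : (bar_ext_inv u).1 s =
  bar_act (fun s => beta u.2^-1%g u.2 s - u.1 s) u.2^-1%g s.
Proof.
apply: ncochain_ofE; [apply: normalized_act|apply: of_size_act] => t tP.
  by rewrite ncochain_normalized // [b _]beta_normalized // subr0.
by rewrite ncochain_of_size // [b _]beta_size // subr0.
Qed.

Let bar_ext_mulA : associative bar_ext_mul.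
Proof.
move=> u v w; congr pair; last exact: mulgA.
apply: ncochainP => s; rewrite !mulE /=.
rewrite (eq_bar_act (mulE u v)) bar_actB bar_actD bar_actM.
have := beta_cocycle u.2 v.2 w.2 s.
rewrite addrC => /eqP; rewrite -subr_eq => /eqP <-; ring.
Qed.

Let bar_ext_mul1 : left_id bar_ext_one bar_ext_mul.
Proof.
move=> [m x]; congr pair; last exact: mul1g.
by apply: ncochainP => s; rewrite mulE /= beta1x bar_act0 // add0r subr0.
Qed.

Let bar_ext_mulV : left_inverse bar_ext_one bar_ext_inv bar_ext_mul.
Proof.
move=> u; congr pair; last exact: mulVg.
apply: ncochainP => s; rewrite mulE oneE (eq_bar_act (invE u)) bar_actM mulVg.
rewrite bar_act1 => [|t t1]; first by ring.
by rewrite ncochain_normalized // beta_normalized // subr0.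
Qed.

HB.instance Definition _ := Finite_isGroup.Build bar_ext
  bar_ext_mulA bar_ext_mul1 bar_ext_mulV.

Lemma bar_ext_mulE (u v : bar_ext) s : (u * v)%g.1 s =
  bar_act u.1 v.2 s + v.1 s - b [:: u.2, v.2 & s].
Proof. exact: mulE. Qed.

Lemma bar_ext_oneE s : (1%g : bar_ext).1 s = 0.
Proof. exact: oneE. Qed.

Definition bar_ext_proj (u : bar_ext) : K := u.2.

Lemma bar_ext_projM : {morph bar_ext_proj : u v / (u * v)%g}.
Proof. by []. Qed.

(** The tautological primitive: on the extension, the [V]-component of the first
    argument is a 1-cochain with values in [V] whose coboundary is the factor
    set. *)
Definition bar_ext_prim (es : seq bar_ext) : F :=
  if es is u :: es' then u.1 (map bar_ext_proj es') else 0.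

Lemma bar_ext_prim_normalized : normalized bar_ext_prim.
Proof.
move=> [|u es] //; rewrite inE => /predU1P[<-|es1] /=; first exact: bar_ext_oneE.
by apply: ncochain_normalized; apply/mapP; exists 1%g.
Qed.

Lemma bar_ext_prim_size : of_size k.+1 bar_ext_prim.
Proof.
by move=> [|u es] //= sk; apply: ncochain_of_size; rewrite size_map.
Qed.

Lemma bar_ext_prim_diff es : bar_diff bar_ext_prim es = b (map bar_ext_proj es).
Proof.
case: es => [|u [|v es]] /=.
- by rewrite ncocycle_of_size.
- by rewrite subrr ncocycle_of_size.
- have -> : bar_act (slice bar_ext_prim u) v es =
    bar_act u.1 v.2 (map bar_ext_proj es) by apply: bar_act_map bar_ext_projM.
  by rewrite bar_ext_mulE /bar_ext_proj; ring.
Qed.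

(** A lift [(m, t)] squares to [(m + t m - b (t, t, -), 1)]. If 2 is invertible,
    half of the invariant cochain [b (t, t, -)] is a solution; otherwise
    [local_solution] applies, whose last clause gives the vanishing of the
    primitive. *)
Lemma bar_ext_lift (t : K) : (t * t)%g = 1%g ->
    (2%:R = 0 :> F -> b (nseq k.+2 t) = 0) ->
  exists u : bar_ext, [/\ (u * u)%g = 1%g, bar_ext_proj u = t
    & 2%:R = 0 :> F -> bar_ext_prim (nseq k.+1 u) = 0].
Proof.
move=> tt1 bt; have [->|t1] := eqVneq t 1%g.
  exists 1%g; split=> [||_]; [exact: mul1g|by []|].
  by rewrite bar_ext_prim_normalized // mem_head.
have betat s : bar_act (beta t t) t s = beta t t s.
  by have := beta_cocycle t t t s; rewrite tt1 beta1x betax1 !addr0.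
have [F2|F2] := eqVneq (2%:R : F) 0.
  (* The smaller of w and t w represents the orbit, up to a global swap which
     makes 1 a representative. *)
  pose rho w := (enum_rank w < enum_rank (t * w)%g)%N
    == (enum_rank (1%g : K) < enum_rank t)%N.
  have rho1 : rho 1%g by rewrite /rho mulg1.
  have rhot w : rho (t * w)%g = ~~ rho w.
    rewrite /rho mulgA tt1 mul1g ltn_neqAle leqNgt.
    rewrite (inj_eq val_inj) (inj_eq enum_rank_inj) -{2}[w]mul1g (inj_eq (mulIg w)) t1.
    by case: (_ < _)%N; case: (_ < _)%N.
  have [m [mu mk mE m0]] :=
    local_solution F2 tt1 rho1 rhot (@beta_normalized t t) (@beta_size t t) betat (bt F2).
  exists (ncochain_of k m, t); split=> // [|_].
    congr pair => //; apply: ncochainP => s.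
    have umE := ncochain_ofE mu mk.
    by rewrite mulE oneE /= (eq_bar_act umE) umE [X in X - _]addrC mE subrr.
  rewrite /bar_ext_prim /= map_nseq.
  by rewrite ncochain_ofE.
pose m s := 2%:R^-1 * beta t t s.
have mu : normalized m by move=> s s1; rewrite /m beta_normalized // mulr0.
have mk : of_size k m by move=> s sk; rewrite /m beta_size // mulr0.
have umE := ncochain_ofE mu mk.
exists (ncochain_of k m, t); split=> // [|/eqP]; last by rewrite (negPf F2).
congr pair => //; apply: ncochainP => s.
rewrite mulE oneE /= (eq_bar_act umE) umE.
rewrite (@bar_act_lin _ _ 2%:R^-1 (beta t t) (fun=> 0)) => [|r]; last by rewrite addr0.
by rewrite (@bar_act0 _ _ (fun=> 0)) // addr0 betat /m; field.
Qed.

End BarExtension.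

(** * Finite groups as discrete topological groups, and inflation of cochains *)

Section BarComplex.
Variables (G : topologicalGroupType) (F : fieldType).

Lemma bar_act_face (f : seq G -> F) x s :
  bar_act f x s = \sum_(i < (size s).+1) (-1) ^+ i * f (face i.+1 (x :: s)).
Proof.
elim: s f x => [|y s IH] f x /=.
  by rewrite big_ord_recl big_ord0 addr0 mul1r face1.
rewrite big_ord_recl /= mul1r face1_cons IH; congr (_ + _).
rewrite -sumrN; apply: eq_bigr => i _.
by rewrite face_cons exprS mulN1r mulNr.
Qed.

Lemma cochain_diff_bar (f : seq G -> F) s : cochain_diff_fun f s = bar_diff f s.
Proof.
case: s => [|x s] //=; rewrite /cochain_diff_fun /= big_ord_recl mul1r.
congr (_ + _); rewrite bar_act_face -sumrN; apply: eq_bigr => i _.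
by rewrite exprS mulN1r mulNr.
Qed.

End BarComplex.

Definition discrete_group (K : finGroupType) : Type := discrete_topology K.
HB.instance Definition _ (K : finGroupType) :=
  Topological.copy (discrete_group K) (discrete_topology K).
HB.instance Definition _ (K : finGroupType) := monoid.Group.copy (discrete_group K) K.

Section DiscreteGroup.
Variable K : finGroupType.

Lemma discrete_group_near (x : discrete_group K) : \forall y \near x, y = x.
Proof. exact: (@discrete_set1 (discrete_topology K) x). Qed.

Lemma discrete_group_mulg_continuous :
  continuous (fun x : discrete_group K * discrete_group K => (x.1 * x.2)%g).
Proof.
move=> [x y] A /= nA.
exists ([set x], [set y]) => /=.
  by split; exact: discrete_group_near.
by move=> [a b] /= [-> ->]; exact: nbhs_singleton.
Qed.

Lemma discrete_group_invg_continuous :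
  continuous (fun x : discrete_group K => x^-1%g).
Proof.
move=> x A /= nA; have nx := @discrete_group_near x.
apply: (@filterS _ (nbhs x) (@nbhs_filter (discrete_group K) x) _ _ _ nx) => y /= ->.
exact: nbhs_singleton.
Qed.

HB.instance Definition _ := isTopologicalGroup.Build (discrete_group K)
  discrete_group_mulg_continuous discrete_group_invg_continuous.

End DiscreteGroup.

Section Pullback.
Variables (G : topologicalGroupType) (K : finGroupType) (F : fieldType).
Variable psi : G -> K.
Hypothesis psi_continuous : continuous (psi : G -> discrete_topology K).

Lemma map_continuous_in_degree (f : seq K -> F) n :
  continuous_in_degree (fun s : seq G => f (map psi s)) n.
Proof.
apply/continuous_in_degreeP => x.
have H : \forall y \near x, forall i : 'I_n, psi (y i) = psi (x i).
  apply: (@filter_forall _ _ _ (nbhs x) (@nbhs_pfilter {ptws 'I_n -> G} x)) => i.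
  have pc : continuous ((fun y => psi (y i)) : {ptws 'I_n -> G} -> discrete_topology K).
    move=> y; apply: (@continuous_comp {ptws 'I_n -> G} G (discrete_topology K)
      (@proj _ (fun=> G) i) psi).
      exact: (@proj_continuous 'I_n (fun=> G) i y).
    exact: psi_continuous.
  exact: (pc x _ (@discrete_set1 (discrete_topology K) (psi (x i)))).
apply: (@filterS _ (nbhs x) (@nbhs_filter {ptws 'I_n -> G} x) _ _ _ H) => y yx.
by congr f; rewrite -!map_comp; exact: eq_map.
Qed.

Lemma pullback_subproof (f : cochain (discrete_group K) F) :
  (fun s : seq G => f (map psi s)) \in @cochain_pred G F.
Proof.
have /cochainP[[N fN] _] := cochain_fun_subproof f.
apply/cochainP; split; last exact: map_continuous_in_degree.
by exists N => s Ns; rewrite fN // size_map.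
Qed.

Definition pullback (f : cochain (discrete_group K) F) : cochain G F :=
  Cochain (pullback_subproof f).

Lemma pullbackE (f : cochain (discrete_group K) F) s :
  pullback f s = f (map psi s).
Proof. by []. Qed.

Lemma pullbackD f g : pullback (f + g) = pullback f + pullback g.
Proof. exact: cochainE. Qed.

Lemma pullbackZ c f : pullback (c *: f) = c *: pullback f.
Proof. exact: cochainE. Qed.

Lemma pullback0 : pullback 0 = 0.
Proof. exact: cochainE. Qed.

Lemma pullback_sum (I : Type) (r : seq I) (u : I -> cochain (discrete_group K) F) :
  pullback (\sum_(i <- r) u i) = \sum_(i <- r) pullback (u i).
Proof. by apply: (big_morph _ pullbackD pullback0). Qed.

Lemma pullbackM f g : pullback (f * g) = pullback f * pullback g.
Proof.
apply: cochainE => s; rewrite pullbackE !cochain_mulE /cochain_cup_fun size_map.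
by apply: eq_bigr => i _; rewrite -map_take -map_drop.
Qed.

Lemma pullback_homog d f : cochain_homog d f -> cochain_homog d (pullback f).
Proof. by move=> fd s sd; apply: fd; rewrite size_map. Qed.

Lemma pullback_diff f : {morph psi : x y / (x * y)%g} ->
  pullback (cochain_diff f) = cochain_diff (pullback f).
Proof.
move=> psiM; apply: cochainE => s; rewrite pullbackE /= !cochain_diff_bar.
by rewrite -(bar_diff_map _ _ psiM).
Qed.

End Pullback.

Section DiscreteCochains.
Variables (K : finGroupType) (F : fieldType).
Notation C := (cochain (discrete_group K) F).

Lemma discrete_cochain_subproof k (f : seq K -> F) : of_size k f ->
  f \in @cochain_pred (discrete_group K) F.
Proof.
move=> fk; apply/cochainP; split.
  by exists k => s ks; rewrite fk // neq_ltn ks orbT.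
move=> n; have := @map_continuous_in_degree (discrete_group K) K F id _ f n.
have -> : (fun s => f (map id s)) = f by apply/funext => s; rewrite map_id.
by apply; move=> x; exact: cvg_id.
Qed.

Definition discrete_cochain k f (fk : of_size k f) : C :=
  Cochain (discrete_cochain_subproof fk).

Lemma discrete_diffE (f : C) s :
  cochain_diff f s = @bar_diff K F (f : seq K -> F) s.
Proof. exact: (@cochain_diff_bar (discrete_group K)). Qed.

End DiscreteCochains.

(** * The obstruction to the next entry of a defining system *)

Section Obstruction.
Variables (F : fieldType) (C : dgAlgebra F) (d : nat -> int).
Implicit Types (A : nat -> nat -> C) (i j k l : nat).

Definition obstruction A i j : C :=
  \sum_(i.+1 <= k < j) massey_bar (massey_deg d i k) (A i k) * A k j.

Lemma sign_mul (a b c e : int) : a + b = c + e + e ->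
  (-1 : F) ^ a * (-1) ^ b = (-1) ^ c.
Proof.
move=> abc; rewrite -exprzDr ?unitrN1 // abc !exprzDr ?unitrN1 // -mulrA.
by rewrite -expfzMl mulrNN mulr1 exp1rz mulr1.
Qed.

Lemma massey_degD i k j : (i <= k <= j)%N ->
  massey_deg d i k + massey_deg d k j = massey_deg d i j + 1.
Proof.
move=> /andP[ik kj]; rewrite /massey_deg (big_cat_nat ik kj) /=.
by ring.
Qed.

Lemma dg_homog_sum e (r : seq nat) (u : nat -> C) :
  (forall k, k \in r -> dg_homog e (u k)) -> dg_homog e (\sum_(k <- r) u k).
Proof.
elim: r => [|i r IH] ur; first by rewrite big_nil; exact: dg_homog0.
rewrite big_cons -[u i]scale1r; apply: dg_homogP; first by apply: ur; rewrite mem_head.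
by apply: IH => k kr; apply: ur; rewrite inE kr orbT.
Qed.

Lemma obstruction_homog A i j :
    (forall k, (i < k < j)%N -> dg_homog (massey_deg d i k) (A i k)) ->
    (forall k, (i < k < j)%N -> dg_homog (massey_deg d k j) (A k j)) ->
  dg_homog (massey_deg d i j + 1) (obstruction A i j).
Proof.
move=> hl hr; apply: dg_homog_sum => k; rewrite mem_index_iota => ikj.
rewrite -(@massey_degD i k j); last by case/andP: ikj => /ltnW-> /ltnW->.
apply: dg_homogM; last exact: hr.
by apply: dg_homogZ; exact: hl.
Qed.

Lemma exchange_triangle (V : zmodType) (X : nat -> nat -> V) i j :
  \sum_(i.+1 <= k < j) \sum_(i.+1 <= l < k) X l k =
  \sum_(i.+1 <= l < j) \sum_(l.+1 <= k < j) X l k.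
Proof.
rewrite [RHS](_ : _ = \sum_(i.+1 <= l < j) \sum_(i.+1 <= k < j | (l < k)%N) X l k).
  rewrite (exchange_big_dep_nat xpredT) //=; apply: eq_big_nat => k /andP[_ kj].
  by rewrite (big_nat_widen _ _ j) 1?ltnW.
apply: eq_big_nat => l /andP[il lj].
by rewrite (big_nat_widenl _ i.+1) 1?ltnW //=.
Qed.

(** By the Leibniz rule the differential is a sum over [i < l < k < j] minus the
    same sum, the signs being accounted for by [massey_degD]. *)
Lemma obstruction_closed A i j :
    (forall k l, (i <= k < l)%N -> (l <= j)%N -> (l - k < j - i)%N ->
       dg_homog (massey_deg d k l) (A k l) /\
       dg_diff C (A k l) = obstruction A k l) ->
  dg_diff C (obstruction A i j) = 0.
Proof.
move=> hA.
have hl k : (i < k < j)%N -> dg_homog (massey_deg d i k) (A i k) /\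
    dg_diff C (A i k) = obstruction A i k.
  by move=> ikj; apply: hA; lia.
have hr k : (i < k < j)%N -> dg_homog (massey_deg d k j) (A k j) /\
    dg_diff C (A k j) = obstruction A k j.
  by move=> ikj; apply: hA; lia.
rewrite /obstruction raddf_sum /=.
rewrite (@eq_big_nat _ _ _ _ _ _ (fun k =>
   \sum_(i.+1 <= l < k) A i l * massey_bar (massey_deg d l k) (A l k) * A k j
 - \sum_(k.+1 <= l < j) A i k * massey_bar (massey_deg d k l) (A k l) * A l j)).
  by rewrite sumrB exchange_triangle subrr.
move=> k ikj; have [hk dk] := hl k ikj; have [hk' dk'] := hr k ikj.
rewrite (@dg_leibniz _ _ (massey_deg d i k)); last exact: dg_homogZ.
rewrite {1 2}/massey_bar linearZ /= dk dk' -!scalerAl scalerA.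
rewrite (@sign_mul _ _ 1 (massey_deg d i k)) 1?expr1z ?scaleN1r; last by ring.
congr (_ - _).
  rewrite /obstruction mulr_suml scaler_sumr; apply: eq_big_nat => l ilk.
  rewrite /massey_bar -!scalerAl -scalerAr -scalerAl scalerA; congr (_ *: _).
  have e_deg : massey_deg d i l + massey_deg d l k = massey_deg d i k + 1.
    by apply: massey_degD; lia.
  apply: (@sign_mul _ _ _ (massey_deg d i l)); lia.
rewrite mulr_sumr; apply: eq_bigr => l _.
by rewrite mulrA.
Qed.

End Obstruction.

(** * Killing obstructions while lifting involutions *)

Section Covers.
Variables (I : Type) (F : finFieldType).

Notation cochains K := (cochain_dga (discrete_group K) F).

(** A surjection onto [K] in which the chosen elements [tau i], of order dividing
    2, have chosen lifts of order dividing 2. *)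
Record cover (K : finGroupType) (tau : I -> K) := Cover {
  cover_group : finGroupType;
  cover_map :> cover_group -> K;
  cover_mapM : {morph cover_map : x y / (x * y)%g};
  cover_surj : forall h, exists x, cover_map x = h;
  cover_lift : I -> cover_group;
  cover_liftK : forall i, cover_map (cover_lift i) = tau i;
  cover_lift2 : forall i, (cover_lift i * cover_lift i)%g = 1%g
}.

Lemma discrete_continuous (K' K : finGroupType) (pi : K' -> K) :
  continuous (pi : discrete_group K' -> discrete_topology K).
Proof.
move=> x A /= nA; have nx := @discrete_group_near K' x.
apply: (@filterS _ (nbhs x) (@nbhs_filter (discrete_group K') x) _ _ _ nx) => y /= ->.
exact: nbhs_singleton nA.
Qed.

Definition cover_pull (K : finGroupType) (tau : I -> K) (c : cover tau) (f : cochains K) :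
    cochains (cover_group c) :=
  pullback (@discrete_continuous _ _ c) f.

Definition cover_id (K : finGroupType) (tau : I -> K)
  (tau2 : forall i, (tau i * tau i)%g = 1%g) : cover tau.
Proof. by exists K id tau => // h; exists h. Defined.

Definition cover_comp (K : finGroupType) (tau : I -> K) (c : cover tau)
  (c' : cover (cover_lift c)) : cover tau.
Proof.
exists (cover_group c') (fun x => c (c' x)) (cover_lift c').
- by move=> x y; rewrite !cover_mapM.
- move=> h; have [x <-] := cover_surj c h; have [y <-] := cover_surj c' x.
  by exists y.
- by move=> i; rewrite !cover_liftK.
- exact: cover_lift2.
Defined.

Lemma cover_pull_comp (K : finGroupType) (tau : I -> K) (c : cover tau)
    (c' : cover (cover_lift c)) (f : cochains K) :
  cover_pull (cover_comp c') f = cover_pull c' (cover_pull c f).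
Proof. by apply: cochainE => s; rewrite /= -map_comp. Qed.

Lemma cover_pull_id (K : finGroupType) (tau : I -> K) tau2 (f : cochains K) :
  cover_pull (@cover_id K tau tau2) f = f.
Proof. by apply: cochainE => s; rewrite /= map_id. Qed.

(** For a normalized cocycle [f] of positive degree in characteristic 2, this says
    that the class of [f] restricts to zero on the group generated by each
    [tau i]. *)
Definition vanishes_on (K : finGroupType) (tau : I -> K) (f : seq K -> F) :=
  2%:R = 0 :> F -> forall i n, f (nseq n (tau i)) = 0.

Lemma normalized_pull (K : finGroupType) (tau : I -> K) (c : cover tau) (f : cochains K) :
  normalized (f : seq K -> F) -> normalized (cover_pull c f : seq (cover_group c) -> F).
Proof.
move=> fu s s1; rewrite /= fu //; apply/mapP; exists 1%g => //.
by apply: (mulgI (c 1%g)); rewrite mulg1 -cover_mapM mulg1.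
Qed.

Lemma vanishes_on_pull (K : finGroupType) (tau : I -> K) (c : cover tau) (f : cochains K) :
  vanishes_on tau (f : seq K -> F) ->
  vanishes_on (cover_lift c) (cover_pull c f : seq (cover_group c) -> F).
Proof. by move=> fv F2 i n; rewrite /= map_nseq cover_liftK fv. Qed.

Lemma cover_pull_diff (K : finGroupType) (tau : I -> K) (c : cover tau) (f : cochains K) :
  cover_pull c (dg_diff _ f) = dg_diff _ (cover_pull c f).
Proof.
exact: (@pullback_diff _ _ _ _ (@discrete_continuous _ _ c) f (@cover_mapM _ _ c)).
Qed.

Lemma cover_pull_homog (K : finGroupType) (tau : I -> K) (c : cover tau) d (f : cochains K) :
  dg_homog d f -> dg_homog d (cover_pull c f).
Proof. exact: pullback_homog. Qed.

(** The last clause keeps the entries of a defining system equal to zero on the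
    intervals which contain a zero class. *)
Definition trivializes (K : finGroupType) (tau : I -> K) (c : cover tau) (d : int)
    (b : cochains K) (A : cochains (cover_group c)) :=
  [/\ dg_homog d A, dg_diff _ A = cover_pull c b,
      normalized (A : seq (cover_group c) -> F),
      vanishes_on (cover_lift c) (A : seq (cover_group c) -> F)
    & b = 0 -> A = 0].

Definition trivializable (K : finGroupType) (tau : I -> K) (d : int) (b : cochains K) :=
  [/\ dg_homog (d + 1) b, dg_diff _ b = 0, normalized (b : seq K -> F),
      vanishes_on tau (b : seq K -> F) & (1 <= d) \/ b = 0].

Lemma trivialize_one (K : finGroupType) (tau : I -> K) d (b : cochains K) :
    (forall i, (tau i * tau i)%g = 1%g) -> trivializable tau d b ->
  exists (c : cover tau) A, trivializes (c := c) d b A.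
Proof.
move=> tau2 [bd db bu bv d1]; have [b0|b0] := pselect (b = 0).
  exists (cover_id tau2), 0; split=> //.
  by rewrite b0 cover_pull_id raddf0.
case: d1 => [d1|//].
have [k dk] : exists k : nat, d = k.+1 by case: d d1 {bd} => [[|k]|k] //; exists k.
have bk : of_size k.+2 (b : seq K -> F).
  by move=> s sk; apply: bd; rewrite dk -PoszD addn1.
have bc : bar_diff (b : seq K -> F) =1 fun=> 0.
  move=> s; rewrite -discrete_diffE.
  by have := congr1 (fun f : cochains K => f s) db.
pose z := NCocycle bu bk bc.
have /choice[lift liftP] i : exists u : bar_ext z, [/\ (u * u)%g = 1%g,
    bar_ext_proj u = tau i & 2%:R = 0 :> F -> bar_ext_prim (nseq k.+1 u) = 0].
  by apply: bar_ext_lift => // F2; exact: bv.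
have c2 i : (lift i * lift i)%g = 1%g by case: (liftP i).
have cK i : bar_ext_proj (lift i) = tau i by case: (liftP i).
have csurj h : exists x : bar_ext z, bar_ext_proj x = h by exists ((1%g : bar_ext z).1, h).
pose c := Cover (@bar_ext_projM K F k z) csurj cK c2.
exists c, (discrete_cochain (@bar_ext_prim_size K F k z)); split.
- move=> s; rewrite dk => sk; exact: (@bar_ext_prim_size K F k z).
- apply: cochainE => s; rewrite [LHS]discrete_diffE.
  change (@bar_diff (bar_ext z) F (@bar_ext_prim K F k z) s
    = b (map (@bar_ext_proj K F k z) s)).
  exact: (bar_ext_prim_diff s).
- exact: bar_ext_prim_normalized.
- move=> F2 i n; have [->|nk] := eqVneq n k.+1.
    by have [_ _ l0] := liftP i; exact: l0.
  by apply: bar_ext_prim_size; rewrite size_nseq.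
- by move/b0.
Qed.

(** One extension for each obstruction, which is first inflated to the extensions
    built for the previous ones. *)
Lemma trivialize_family (K : finGroupType) (tau : I -> K) (r : nat) (d : nat -> int)
    (b : nat -> cochains K) :
    (forall i, (tau i * tau i)%g = 1%g) ->
    (forall i, (i < r)%N -> trivializable tau (d i) (b i)) ->
  exists (c : cover tau) A, forall i, (i < r)%N -> trivializes (c := c) (d i) (b i) (A i).
Proof.
move=> tau2; elim: r => [|r IH] bP; first by exists (cover_id tau2), (fun=> 0).
have [|c [A AP]] := IH; first by move=> i ir; apply: bP; rewrite ltnS ltnW.
have [|c' [B BP]] := @trivialize_one _ (cover_lift c) (d r) (cover_pull c (b r))
  (cover_lift2 c).
  have [bd db bu bv br] := bP r (ltnSn r); split.
  - exact: cover_pull_homog.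
  - by rewrite -cover_pull_diff db; exact: pullback0.
  - exact: normalized_pull.
  - exact: vanishes_on_pull.
  - by case: br => [|->]; [left|right; exact: pullback0].
exists (cover_comp c'), (fun i => if i == r then B else cover_pull c' (A i)) => i.
rewrite ltnS leq_eqVlt; have [-> _|ir /= ltir] := eqVneq i r.
  have [Bd dB Bu Bv B0] := BP; split=> //; first by rewrite dB cover_pull_comp.
  by move=> b0; apply: B0; rewrite b0; exact: pullback0.
have [Ad dA Au Av A0] := AP i ltir; split.
- exact: (@cover_pull_homog _ _ c' _ _ Ad).
- have := cover_pull_diff c' (A i); rewrite dA => <-.
  exact: esym (cover_pull_comp c' (b i)).
- exact: (@normalized_pull _ _ c' _ Au).
- exact: (@vanishes_on_pull _ _ c' _ Av).
- by move=> /A0->; exact: pullback0.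
Qed.

End Covers.

(** * Defining systems over a finite group *)

Section Tower.
Variables (I : Type) (F : finFieldType).
Notation cochains K := (cochain_dga (discrete_group K) F).

Lemma normalized_mul (K : finGroupType) (f g : cochains K) :
  normalized (f : seq K -> F) -> normalized (g : seq K -> F) ->
  normalized ((f * g : cochains K) : seq K -> F).
Proof.
move=> fu gu s s1; rewrite cochain_mulE; apply: big1 => i _.
have : (1%g : K) \in take i s ++ drop i s by rewrite cat_take_drop.
by rewrite mem_cat => /orP[/fu|/gu] ->; rewrite ?mul0r ?mulr0.
Qed.

Lemma vanishes_on_mull (K : finGroupType) (tau : I -> K) (f g : cochains K) :
  vanishes_on tau (f : seq K -> F) ->
  vanishes_on tau ((f * g : cochains K) : seq K -> F).
Proof.
move=> fv F2 i n; rewrite cochain_mulE; apply: big1 => k _.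
rewrite take_nseq; last by case: k => k /=; rewrite size_nseq ltnS.
by rewrite [f _](fv F2) mul0r.
Qed.

Lemma vanishes_on_mulr (K : finGroupType) (tau : I -> K) (f g : cochains K) :
  vanishes_on tau (g : seq K -> F) ->
  vanishes_on tau ((f * g : cochains K) : seq K -> F).
Proof.
move=> gv F2 i n; rewrite cochain_mulE; apply: big1 => k _.
by rewrite drop_nseq [g _](gv F2) mulr0.
Qed.

Lemma normalized_bar (K : finGroupType) e (f : cochains K) :
  normalized (f : seq K -> F) -> normalized (massey_bar e f : seq K -> F).
Proof. by move=> fu s s1; rewrite /massey_bar cochain_scaleE fu // mulr0. Qed.

Lemma vanishes_on_barM (K : finGroupType) (tau : I -> K) e (f g : cochains K) :
  vanishes_on tau ((f * g : cochains K) : seq K -> F) ->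
  vanishes_on tau ((massey_bar e f * g : cochains K) : seq K -> F).
Proof.
move=> fgv F2 i n; rewrite /massey_bar -scalerAl cochain_scaleE.
by rewrite [X in _ * X](fgv F2) mulr0.
Qed.

Lemma massey_deg_ge1 (d : nat -> int) i j : (i < j)%N ->
  (forall s, (i <= s < j)%N -> 1 <= d s) -> 1 <= massey_deg d i j.
Proof.
move=> ij d1; have : \sum_(i <= s < j) (1 : int) <= \sum_(i <= s < j) d s.
  by apply: ler_sum_nat.
by rewrite sumr_const_nat /massey_deg; lia.
Qed.

Lemma obstruction_pull (K : finGroupType) (tau : I -> K) (c : cover tau)
    (d : nat -> int) (A : nat -> nat -> cochains K) i j :
  obstruction d (fun k l => cover_pull c (A k l)) i j =
  cover_pull c (obstruction d A i j).
Proof.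
rewrite /obstruction [RHS](pullback_sum (discrete_continuous (pi := c))).
by apply: eq_bigr => k _; rewrite [RHS]pullbackM pullbackZ.
Qed.

Lemma eq_obstruction (C : dgAlgebra F) (d : nat -> int) (A B : nat -> nat -> C) i j :
    (forall k, (i < k < j)%N -> A i k = B i k) ->
    (forall k, (i < k < j)%N -> A k j = B k j) ->
  obstruction d A i j = obstruction d B i j.
Proof. by move=> hl hr; apply: eq_big_nat => k ikj; rewrite hl ?hr. Qed.

(** A defining system on the intervals of length at most [m + 1], strengthened by
    what the next obstructions need: normalization, vanishing at the chosen
    involutions above the diagonal, and vanishing on the intervals which contain a
    zero class. *)
Definition partial_system (K : finGroupType) (tau : I -> K) (r : nat) (d : nat -> int)
    (z : nat -> cochains K) (c : cover tau) (m : nat)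
    (A : nat -> nat -> cochains (cover_group c)) :=
  (forall i, A i i.+1 = cover_pull c (z i)) /\
  forall i j, (i < j <= r)%N -> (j - i <= m.+1)%N ->
    [/\ dg_homog (massey_deg d i j) (A i j),
        dg_diff _ (A i j) = obstruction d A i j,
        normalized (A i j : seq (cover_group c) -> F),
        (i.+1 < j)%N ->
          vanishes_on (cover_lift c) (A i j : seq (cover_group c) -> F)
      & (exists2 s, (i <= s < j)%N & z s = 0) -> A i j = 0].

(** In the obstruction for an interval of length at least 3, each product has a
    factor above the diagonal, which vanishes at the chosen involutions; for length
    2 it is the product of two consecutive cocycles, where the hypothesis applies. If no
    class of the interval is zero then all degrees are positive, so that the
    obstruction has degree at least 2; otherwise the obstruction is zero. *)
Lemma partial_system_exists (K : finGroupType) (tau : I -> K) (r : nat)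
    (d : nat -> int) (z : nat -> cochains K) :
    (forall i, (tau i * tau i)%g = 1%g) ->
    (forall i, [/\ dg_homog (d i) (z i), dg_diff _ (z i) = 0
      & normalized (z i : seq K -> F)]) ->
    (forall i, z i <> 0 -> z i.+1 <> 0 -> 1 <= d i /\ 1 <= d i.+1) ->
    (forall i, vanishes_on tau ((z i * z i.+1 : cochains K) : seq K -> F)) ->
  forall m, exists (c : cover tau) A, @partial_system K tau r d z c m A.
Proof.
move=> tau2 zP znz zz; elim=> [|m [c [A [A1 AP]]]].
  exists (cover_id tau2), (fun i j => if j == i.+1 then z i else 0).
  split=> [i|i j]; first by rewrite eqxx cover_pull_id.
  move=> /andP[ij jr] ji; have -> : j = i.+1 by lia.
  have [zd dz zu] := zP i; rewrite eqxx ltnn; split=> //.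
  - by rewrite /massey_deg big_nat1 (_ : _ - _ = d i) //; lia.
  - by rewrite dz /obstruction big_geq.
  - by move=> [s]; rewrite ltnS => /anti_leq ->.
have bad0 i : (i < r - m.+1)%N ->
    (exists2 s, (i <= s < i + m.+2)%N & z s = 0) -> obstruction d A i (i + m.+2) = 0.
  move=> ir [s sij zs]; rewrite /obstruction; apply: big1_seq => k /=.
  rewrite mem_index_iota => ikj.
  have [sk|ks] := ltnP s k.
    have [||_ _ _ _ b0] := AP i k; [lia|lia|].
    by rewrite b0 /massey_bar ?scaler0 ?mul0r //; exists s => //; lia.
  have [||_ _ _ _ b0] := AP k (i + m.+2)%N; [lia|lia|].
  by rewrite b0 ?mulr0 //; exists s => //; lia.
have bP i : (i < r - m.+1)%N -> trivializable (cover_lift c)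
    (massey_deg d i (i + m.+2)) (obstruction d A i (i + m.+2)).
  move=> ir; pose j := (i + m.+2)%N.
  have hl k : (i < k < j)%N -> (i < k <= r)%N && (k - i <= m.+1)%N by rewrite /j; lia.
  have hr k : (i < k < j)%N -> (k < j <= r)%N && (j - k <= m.+1)%N by rewrite /j; lia.
  split.
  - apply: obstruction_homog => k.
    + by move=> /hl/andP[ik ki]; have [] := AP _ _ ik ki.
    + by move=> /hr/andP[ik ki]; have [] := AP _ _ ik ki.
  - apply: obstruction_closed => k l kl lj lk.
    have [||? ? _ _ _] := AP k l; [lia|lia|by split].
  - move=> s s1; rewrite /obstruction cochain_sumE; apply: big1_seq => k /=.
    rewrite mem_index_iota => ikj.
    have /andP[ik ki] := hl _ ikj; have /andP[kj jk] := hr _ ikj.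
    have [_ _ u1 _ _] := AP _ _ ik ki; have [_ _ u2 _ _] := AP _ _ kj jk.
    exact: (normalized_mul (normalized_bar _ u1) u2).
  - move=> F2 t n; rewrite /obstruction cochain_sumE; apply: big1_seq => k /=.
    rewrite mem_index_iota => ikj.
    have /andP[ik ki] := hl _ ikj; have /andP[kj jk] := hr _ ikj.
    have [_ _ _ v1 _] := AP _ _ ik ki; have [_ _ _ v2 _] := AP _ _ kj jk.
    apply: vanishes_on_barM F2 t n.
    have [ik1|ik1] := ltnP i.+1 k; first exact: vanishes_on_mull (v1 ik1).
    have [kj1|kj1] := ltnP k.+1 j; first exact: vanishes_on_mulr (v2 kj1).
    have -> : k = i.+1 by lia.
    have -> : (i + m.+2)%N = i.+2 by move: kj1; rewrite /j; lia.
    rewrite !A1; have := vanishes_on_pull c (zz i).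
    by rewrite [cover_pull _ _]pullbackM.
  - have [bad|bad] := pselect (exists2 s, (i <= s < j)%N & z s = 0).
      by right; exact: bad0.
    (* All classes of the interval being nonzero, each has a nonzero neighbour. *)
    left; apply: massey_deg_ge1; first lia.
    move=> s sij; have zs t : (i <= t < j)%N -> z t <> 0.
      by move=> tij zt; apply: bad; exists t.
    have [s1j|s1j] := ltnP s.+1 j.
      by have [||? ?] := znz s; [apply: zs; lia|apply: zs; lia|].
    have := znz s.-1; rewrite prednK; last lia.
    by case; [apply: zs; lia|apply: zs; lia|].
have [c' [B BP]] := trivialize_family (cover_lift2 c) bP.
pose A' i j := if j == (i + m.+2)%N then B i else cover_pull c' (A i j).
have A'E k l : (l - k < m.+2)%N -> A' k l = cover_pull c' (A k l).
  by move=> lk; rewrite /A' ifN //; lia.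
have obE i j : (j - i <= m.+2)%N ->
    obstruction d A' i j = cover_pull c' (obstruction d A i j).
  move=> ij; rewrite -obstruction_pull.
  by apply: eq_obstruction => k ikj; apply: A'E; lia.
exists (cover_comp c'), A'; split=> [i|i j ijr].
  by rewrite A'E ?A1 ?cover_pull_comp //; lia.
rewrite leq_eqVlt => /predU1P[ji|ji].
  have jE : j = (i + m.+2)%N by lia.
  have [|Bd dB Bu Bv B0] := BP i; first lia.
  rewrite jE; split; rewrite {1}/A' eqxx //.
  - by rewrite obE //; lia.
  - by rewrite -jE => bad; apply/B0/bad0; [lia|rewrite -jE].
have [|Ad dA Au Av A0] := AP i j ijr; first lia.
have A'ij : A' i j = cover_pull c' (A i j) by apply: A'E; lia.
rewrite A'ij; split.
- exact: (@cover_pull_homog _ _ _ _ c' _ _ Ad).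
- rewrite obE; last lia.
  by have := cover_pull_diff c' (A i j); rewrite dA => <-.
- exact: (@normalized_pull _ _ _ _ c' _ Au).
- by move=> /Av {}Av; exact: (@vanishes_on_pull _ _ _ _ c' _ Av).
- by move=> /A0->; exact: pullback0.
Qed.

End Tower.

(** * Cochains on a compact group come from a finite quotient *)

(** The group law is defined on the image of [rho]. *)
Lemma finite_congruence_quotient (G : groupType) (T : finType) (rho : G -> T) :
    (forall g g' h h', rho g = rho g' -> rho h = rho h' ->
      rho (g * h)%g = rho (g' * h')%g) ->
  exists (H : finGroupType) (phi : G -> H), [/\ {morph phi : x y / (x * y)%g},
    forall h, exists g, phi g = h & forall g g', phi g = phi g' <-> rho g = rho g'].
Proof.
move=> rhoM; pose H : finType := {x : T | `[< exists g, rho g = x >]}.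
have rhoP g : `[< exists g', rho g' = rho g >] by apply/asboolP; exists g.
pose phi g : H := exist (fun x => `[< exists g, rho g = x >]) (rho g) (rhoP g).
have phiE g g' : phi g = phi g' <-> rho g = rho g'.
  by split=> [/(congr1 val)|e] //; apply: val_inj.
have /choice[s sK] (x : H) : exists g, phi g = x.
  by have /asboolP[g gx] := valP x; exists g; apply: val_inj.
pose mul x y := phi (s x * s y)%g.
have phiM g h : phi (g * h)%g = mul (phi g) (phi h).
  by apply/phiE/rhoM; apply/phiE; rewrite sK.
have mulA : associative mul.
  by move=> x y z; rewrite -(sK x) -(sK y) -(sK z) -!phiM mulgA.
have mul1 : left_id (phi 1%g) mul.
  by move=> x; rewrite -(sK x) -phiM mul1g.
have mulV : left_inverse (phi 1%g) (fun x => phi (s x)^-1%g) mul.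
  by move=> x; rewrite -{2}(sK x) -phiM mulVg.
pose HG : finGroupType := HB.pack H (Finite_isGroup.Build H mulA mul1 mulV).
exists HG, phi; split=> //.
by move=> h; exists (s h).
Qed.

Lemma codom_nth (T : Type) (x0 : T) n (s : seq T) : size s = n ->
  codom (fun i : 'I_n => nth x0 s i) = s.
Proof.
move=> sn; apply: (@eq_from_nth _ x0) => [|i]; first by rewrite size_codom card_ord.
rewrite size_codom card_ord => ltin.
by rewrite (nth_map (Ordinal ltin)) ?size_enum_ord //= nth_enum_ord.
Qed.

Lemma continuous_ptws (T U : topologicalType) n (t : T -> {ptws 'I_n -> U}) :
  (forall i, continuous (fun x => t x i)) -> continuous t.
Proof.
move=> tc x; apply/cvg_sup => i.
suff : continuous (t : T -> initial_topology (fun f : 'I_n -> U => f i)) by apply.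
by apply/continuousP => A [B oB <-]; move/continuousP: (tc i); apply.
Qed.

Lemma continuous_in_degree_comp (T : topologicalType) (G : topologicalGroupType)
    (F : fieldType) (f : seq G -> F) n (hs : T -> seq G) :
  continuous_in_degree f n -> (forall x, size (hs x) = n) ->
  (forall k, continuous (fun x => nth 1%g (hs x) k)) ->
  forall x, \forall y \near x, f (hs y) = f (hs x).
Proof.
move=> /continuous_in_degreeP fc hsz hc x.
pose t (y : T) : {ptws 'I_n -> G} := fun i => nth 1%g (hs y) i.
have tc : continuous t by apply: continuous_ptws => i; exact: hc.
have ftx : \forall y \near x, f (codom (t y)) = f (codom (t x)) := tc x _ (fc (t x)).
by apply: filterS ftx => y; rewrite !codom_nth.
Qed.

Section Congruence.
Variables (G : topologicalGroupType) (F : fieldType) (f : seq G -> F) (n : nat).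

(** The elements [x] and [y] make this relation invariant under translations on both
    sides, so that its classes are the cosets of a normal subgroup. *)
Definition indist (g h : G) := forall s1 s2 x y,
  f (s1 ++ (x * g * y)%g :: s2) = f (s1 ++ (x * h * y)%g :: s2).

Lemma indist_mul g g' h h' : indist g g' -> indist h h' -> indist (g * h)%g (g' * h')%g.
Proof.
move=> gg hh s1 s2 x y; have := gg s1 s2 x (h * y)%g.
by rewrite !mulgA => ->; exact: hh.
Qed.

Lemma indist_seq (H : Type) (phi : G -> H) :
  (forall g h, phi g = phi h -> indist g h) ->
  forall s s', map phi s = map phi s' -> f s = f s'.
Proof.
move=> phiP s s'; suff H0 s0 : map phi s = map phi s' -> f (s0 ++ s) = f (s0 ++ s').
  exact: (H0 [::]).
elim: s s' s0 => [|g s IH] [|h s'] s0 //= [gh ss].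
have := phiP _ _ gh s0 s 1%g 1%g; rewrite !mul1g !mulg1 => ->.
by rewrite -!cat_rcons; exact: IH.
Qed.

Hypothesis (Gc : compact [set: G]).
Hypothesis (fn : of_size n f) (fc : continuous_in_degree f n).

(** The tube lemma: [f (s1 ++ (x * h * y) :: s2)] is a locally constant function of
    [h] and of the sequence [w = s1 ++ x :: y :: s2], which ranges over the compact
    space of sequences of size [n + 1]. *)
Lemma indist_near g : \forall h \near g, indist g h.
Proof.
pose W := {ptws 'I_n.+1 -> G}.
pose ins l (h : G) (w : seq G) : seq G :=
  take l w ++ (nth 1 w l * h * nth 1 w l.+1)%g :: drop l.+2 w.
have Wc : compact [set: W].
  have := @tychonoff 'I_n.+1 (fun=> G) (fun=> setT) (fun=> Gc).
  by congr (compact _); apply/seteqP; split.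
have near_l (l : 'I_n) :
    \forall h \near g, forall w : W, f (ins l h (codom w)) = f (ins l g (codom w)).
  have szw (w : W) : size (codom w) = n.+1 by rewrite size_codom card_ord.
  have ln : (l.+2 <= n.+1)%N by rewrite ltnS.
  have cont : forall hw : G * W, \forall hw' \near hw,
      f (ins l hw'.1 (codom hw'.2)) = f (ins l hw.1 (codom hw.2)).
    apply: (@continuous_in_degree_comp (G * W)%type G F f n
      (fun hw => ins l hw.1 (codom hw.2))) => //.
      move=> hw; rewrite size_cat size_takel ?szw; last exact: ltnW (ltnW ln).
      by rewrite /= size_drop szw; lia.
    move=> k.
    have nth_snd j : continuous (fun hw : G * W => nth 1%g (codom hw.2) j).
      move=> hw; apply: (@continuous_comp _ _ _ snd (fun w : W => nth 1%g (codom w) j)).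
        exact: cvg_snd.
      exact: nth_codom_continuous.
    have szt (w : W) : size (take l (codom w)) = l.
      by rewrite size_takel // szw; lia.
    have [kl|lk|->] := ltngtP k l.
    - rewrite (_ : (fun hw : G * W => _) = (fun hw => nth 1%g (codom hw.2) k)) //.
      by apply/funext => hw; rewrite nth_cat szt kl nth_take.
    - rewrite (_ : (fun hw : G * W => _) = (fun hw => nth 1%g (codom hw.2) k.+1)) //.
      apply/funext => hw; rewrite nth_cat szt ltnNge (ltnW lk) /= -(subnSK lk) /=.
      by rewrite nth_drop; congr nth; lia.
    - rewrite (_ : (fun hw : G * W => _) = (fun hw =>
          nth 1 (codom hw.2) l * hw.1 * nth 1 (codom hw.2) l.+1)%g).
        move=> hw; apply: (@continuous_comp _ _ _
          (fun hw : G * W => ((nth 1 (codom hw.2) l * hw.1)%g, nth 1%g (codom hw.2) l.+1))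
          (fun x : G * G => (x.1 * x.2)%g)); last exact: mulg_continuous.
        apply: cvg_pair; last exact: nth_snd.
        apply: (@continuous_comp _ _ _
          (fun hw : G * W => (nth 1%g (codom hw.2) l, hw.1))
          (fun x : G * G => (x.1 * x.2)%g)); last exact: mulg_continuous.
        by apply: cvg_pair; [exact: nth_snd | exact: cvg_fst].
      by apply/funext => hw; rewrite nth_cat szt ltnn subnn.
  have cov := (iffLR (compact_near_coveringP _) Wc) G (nbhs g)
    (fun h w => f (ins l h (codom w)) = f (ins l g (codom w))) _ _.
  have : \forall h \near g, [set: W] `<=`
      (fun w => f (ins l h (codom w)) = f (ins l g (codom w))).
    apply: cov => w _.
    have [/= [A B] [nA nB] AB] := cont (g, w).
    exists (B, A) => //= -[w' h] /= [Bw Ah].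
    rewrite (AB (h, w')) // -(AB (g, w')) //; split => //=.
    exact: nbhs_singleton nA.
  by apply: filterS => h hW w; exact: hW.
have : \forall h \near g, forall (l : 'I_n) (w : W),
    f (ins l h (codom w)) = f (ins l g (codom w)).
  exact: filter_forall.
apply: filterS => h hE s1 s2 x y.
have [sn|sn] := eqVneq (size s1 + (size s2).+1)%N n; last first.
  by rewrite !fn // size_cat.
have ln : (size s1 < n)%N by lia.
pose w : W := fun i => nth 1%g (s1 ++ [:: x, y & s2]) i.
have wE : codom w = s1 ++ [:: x, y & s2].
  by apply: codom_nth; rewrite size_cat /= addnS sn.
have drop2 : drop (size s1).+2 (s1 ++ [:: x, y & s2]) = s2.
  by rewrite -[[:: x, y & s2]]/([:: x; y] ++ s2) catA drop_size_cat // size_cat addn2.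
have := hE (Ordinal ln) w; rewrite /ins /= wE take_size_cat // drop2.
by rewrite !nth_cat ltnn subnn ltnNge leqnSn /= subSnn => <-.
Qed.

End Congruence.

(** Compactness leaves finitely many classes of the open congruence which makes all
    the [f j] indistinguishable. *)
Lemma finite_quotient_factor (G : topologicalGroupType) (F : fieldType) (J : finType)
    (f : J -> seq G -> F) (n : J -> nat) : compact [set: G] ->
    (forall j, of_size (n j) (f j)) -> (forall j, continuous_in_degree (f j) (n j)) ->
  exists (H : finGroupType) (phi : G -> H),
    [/\ {morph phi : x y / (x * y)%g}, forall h, exists g, phi g = h,
        continuous (phi : G -> discrete_topology H)
      & forall j s s', map phi s = map phi s' -> f j s = f j s'].
Proof.
move=> Gc fn fc; pose R g h := forall j, indist (f j) g h.
have Rxx g : R g g by move=> j s1 s2 x y.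
have Rsym g h : R g h -> R h g by move=> gh j s1 s2 x y; rewrite gh.
have Rtrans g h k : R g h -> R h k -> R g k.
  by move=> gh hk j s1 s2 x y; rewrite gh hk.
have Rnear g : \forall h \near g, R g h.
  apply: filter_forall => j.
  exact: (indist_near Gc (fn j) (fc j)).
have Ropen g : open [set h | R g h].
  rewrite openE => h gh; rewrite /interior /=.
  by apply: filterS (Rnear h) => k; exact: Rtrans gh.
(* Finite subcovers are stated for pointed spaces. *)
pose Gp : ptopologicalType := HB.pack (TopologicalGroup.sort G)
  (TopologicalGroup.class G) (isPointed.Build G (1%g : G)).
have cov : @cover_compact Gp [set: G] by rewrite -compact_cover.
have [|g _|D _ GD] := cov G setT (fun g => [set h | R g h]) => //.
  by exists g.
have [x0 _] : exists2 x0 : D, True & True.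
  by have [x xD _] := GD 1%g I; exists [` xD]%fset.
pose rho g : D := odflt x0 [pick x : D | `[< R (val x) g >]].
have rhoP g : R (val (rho g)) g.
  rewrite /rho; case: pickP => [x /asboolP //|none].
  have [x xD xg] := GD g I.
  by have /asboolP[] := none [` xD]%fset.
have rhoE g h : rho g = rho h <-> R g h.
  split=> [gh|gh]; first by apply: Rtrans (rhoP h); rewrite -gh; exact: Rsym.
  rewrite /rho (@eq_pick _ _ (fun x : D => `[< R (val x) h >])) // => x.
  apply/asboolP/asboolP => xg; first exact: Rtrans gh.
  by apply: Rtrans xg _; exact: Rsym.
have [|H [phi [phiM phi_surj phiE]]] := @finite_congruence_quotient G D rho.
  move=> g g' h h' /rhoE gg' /rhoE hh'; apply/rhoE => j.
  by apply: indist_mul.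
exists H, phi; split=> //.
- move=> g A nA; have := Rnear g; apply: filterS => h gh /=.
  suff -> : phi h = phi g by exact: nbhs_singleton nA.
  by apply/phiE/rhoE/Rsym.
- move=> j; apply: indist_seq => g h /phiE/rhoE; exact.
Qed.

(** * Cohomology classes and their representatives *)

Section Representatives.
Variables (F : fieldType) (C : dgAlgebra F).

Lemma pi_cocycle_eq0 d (z : cocycle C d) :
  \pi_(cohom C d) z = 0 <-> exists2 y : C, dg_homog (d - 1) y & dg_diff C y = val z.
Proof.
have -> : 0 = \pi_(cohom C d) (0 : cocycle C d) by rewrite raddf0.
split=> [/eqP|[y hy dy]].
  by rewrite -Quotient.idealrBE subr0 => /asboolP.
by apply/eqP; rewrite -Quotient.idealrBE subr0; apply/asboolP; exists y.
Qed.

Lemma represents_homog d (c : cohom C d) x :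
  represents c x -> dg_homog d x /\ dg_diff C x = 0.
Proof. by move=> [z [<- _]]; have /asboolP := valP z. Qed.

Lemma represents_addd d (c : cohom C d) x y : represents c x -> dg_homog (d - 1) y ->
  represents c (x - dg_diff C y).
Proof.
move=> [z [<- ->]] hy.
have [hz dz] : dg_homog d (val z) /\ dg_diff C (val z) = 0 by have /asboolP := valP z.
have wP : val z - dg_diff C y \in @cocycle_pred F C d.
  apply/asboolP; split; last by rewrite raddfB /= dz dg_diffK subr0.
  apply: dg_homogB => //; rewrite -[d](subrK 1); exact: dg_diff_homog.
exists (Cocycle wP); split=> //; apply/eqP; rewrite -Quotient.idealrBE.
by apply/asboolP; exists y => //=; rewrite opprB addrC subrK.
Qed.

Lemma represents_boundary d (c : cohom C d) x : represents c x ->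
  (exists2 y : C, dg_homog (d - 1) y & dg_diff C y = x) -> c = 0.
Proof. by move=> [z [<- ->]] /pi_cocycle_eq0. Qed.

Lemma represents_zero d y : dg_homog (d - 1) y ->
  represents (0 : cohom C d) (dg_diff C y).
Proof.
move=> hy; have r0 : represents (0 : cohom C d) 0.
  by exists 0; split=> //; rewrite raddf0.
have := represents_addd r0 (dg_homogN hy).
by rewrite sub0r raddfN opprK.
Qed.

Lemma represents_exists d (c : cohom C d) :
  exists x, represents c x /\ (c = 0 -> x = 0).
Proof.
have [->|c0] := pselect (c = 0).
  by exists 0; split=> //; exists 0; split=> //; rewrite raddf0.
by exists (val (repr c)); split=> //; exists (repr c); split=> //; rewrite reprK.
Qed.

Lemma represents_cup d e (a : cohom C d) (b : cohom C e) x y :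
    represents a x -> represents b y -> cup a b = 0 ->
  exists2 u : C, dg_homog (d + e - 1) u & dg_diff C u = x * y.
Proof.
by move=> [z [<- ->]] [w [<- ->]]; rewrite pi_cup => /pi_cocycle_eq0.
Qed.

(** The vanishing of a cup product does not depend on the choice of cocycles. *)
Lemma cup_primitive_shift d e (z z' u y y' : C) :
    dg_homog d z -> dg_diff C z = 0 -> dg_homog (d - 1) y ->
    dg_diff C z' = 0 -> dg_homog e y' -> dg_diff C u = z * z' ->
  exists v, dg_diff C v = (z - dg_diff C y) * (z' - dg_diff C y').
Proof.
move=> zd dz yd dz' y'd du.
exists (u - y * z' - (-1 : F) ^ d *: (z * y') + y * dg_diff C y').
rewrite raddfD !raddfB /= linearZ /= (dg_leibniz _ zd) !(dg_leibniz _ yd).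
rewrite dz dz' dg_diffK du !mulr0 !scaler0 !addr0 mul0r add0r scalerA.
rewrite -expfzMl mulrNN mulr1 exp1rz scale1r mulrBl !mulrBr opprB.
by rewrite [RHS]addrA [RHS]addrAC; congr (_ + _); exact: addrAC.
Qed.

End Representatives.

(** * The finite group of the embedding problem *)

Section FiniteLevel.
Variable F : finFieldType.
Notation cochains K := (cochain_dga (discrete_group K) F).

Lemma normalized_representative (H : finGroupType) d (z : cochains H) :
    dg_homog d z -> dg_diff _ z = 0 ->
  exists y : cochains H, [/\ dg_homog (d - 1) y,
    normalized ((z - dg_diff _ y : cochains H) : seq H -> F) & z = 0 -> y = 0].
Proof.
move=> zd dz; pose h : seq H -> F := normalize_htpy (z : seq H -> F).
have hE e (s : seq H) (f : seq H -> F) : (forall t, (size t)%:Z != e -> f t = 0) ->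
    (size s).+1%:Z != e -> normalize_htpy f s = 0.
  elim: s f e => [|x s IH] f e fe se /=; first by rewrite fe // subr0.
  rewrite fe // sub0r (IH _ (e - 1)) ?oppr0 //; first last.
    by move: se => /=; lia.
  by move=> t te; rewrite !fe ?subrr //=; move: te; lia.
have hd s : (size s).+1%:Z != d -> h s = 0 by apply: hE => t; exact: zd.
have hk : of_size (absz d).-1 h by move=> s sk; apply: hd; case: (d) sk => [[|m]|m].
exists (discrete_cochain hk); split=> [s sd|s s1|z0].
- by apply: hd; apply: contra sd => /eqP <-; rewrite -addn1 PoszD addrK.
- have dz0 t : bar_diff (z : seq H -> F) t = 0.
    rewrite -discrete_diffE.
    by have := congr1 (fun f : cochains H => (f : cochain _ _) t) dz.
  have := normalize_htpyP (z : seq H -> F) s.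
  rewrite (normalizeP _ s1) subr0 (normalize_htpy0 _ dz0) addr0 => zE.
  have dE : (dg_diff _ (discrete_cochain hk : cochains H) : cochain _ _) s =
      bar_diff h s by exact: discrete_diffE.
  transitivity ((z : cochain _ _) s - bar_diff h s); last by rewrite zE subrr.
  by rewrite -dE.
- by apply: cochainE => s; rewrite /= /h normalize_htpy0 // z0.
Qed.

(** The hypotheses of [partial_system_exists] after normalizing the cocycles: the
    product of two consecutive ones is a coboundary, hence vanishes at
    [(t, ..., t)] by [bar_diff_nseq]. *)
Lemma finite_massey_system (H : finGroupType) (r : nat) (d : nat -> int)
    (z : nat -> cochains H) :
    (forall i, dg_homog (d i) (z i)) -> (forall i, dg_diff _ (z i) = 0) ->
    (forall i, z i <> 0 -> z i.+1 <> 0 -> 1 <= d i /\ 1 <= d i.+1) ->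
    (forall i, exists u : cochains H, dg_diff _ u = z i * z i.+1) ->
  exists (tau : H -> H) (c : cover tau) (y : nat -> cochains H)
      (A : nat -> nat -> cochains (cover_group c)),
    [/\ forall h, (h * h)%g = 1%g -> tau h = h,
        forall i, dg_homog (d i - 1) (y i),
        forall i, A i i.+1 = cover_pull c (z i - dg_diff _ (y i))
      & forall i j, (i < j <= r)%N -> dg_homog (massey_deg d i j) (A i j) /\
          dg_diff _ (A i j) = obstruction d A i j].
Proof.
move=> zd dz znz zz.
have /choice[y yP] i := normalized_representative (zd i) (dz i).
pose w i : cochains H := z i - dg_diff _ (y i).
have w0 i : w i <> 0 -> z i <> 0.
  move=> wi zi; apply: wi; have [_ _ y0] := yP i.
  by rewrite /w (y0 zi) zi raddf0 subr0.
(* [tau] enumerates the involutions of [H], other elements being sent to 1. *)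
pose tau (h : H) : H := if (h * h)%g == 1%g then h else 1%g.
have tau2 h : (tau h * tau h)%g = 1%g.
  by rewrite /tau; case: eqP => // _; rewrite mulg1.
have wP i : [/\ dg_homog (d i) (w i), dg_diff _ (w i) = 0 & normalized (w i : seq H -> F)].
  have [yd yu _] := yP i; split=> //.
    by apply: dg_homogB => //; rewrite -[d i](subrK 1); exact: dg_diff_homog.
  have -> : dg_diff _ (w i) = dg_diff _ (z i) - dg_diff _ (dg_diff _ (y i)).
    exact: raddfB.
  by rewrite dz dg_diffK subrr.
have wnz i : w i <> 0 -> w i.+1 <> 0 -> 1 <= d i /\ 1 <= d i.+1.
  by move=> /w0 zi /w0 zi1; exact: znz.
have ww i : exists u : cochains H, dg_diff _ u = w i * w i.+1.
  have [u du] := zz i; have [yd _ _] := yP i.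
  have [yd' _ _] := yP i.+1.
  exact: (cup_primitive_shift (zd i) (dz i) yd (dz i.+1) yd' du).
have wv i : vanishes_on tau ((w i * w i.+1 : cochains H) : seq H -> F).
  move=> F2 h n; have [u du] := ww i.
  have [_ _ u1] := wP i; have [_ _ u2] := wP i.+1.
  have duE : bar_diff (u : seq H -> F) =1 ((w i * w i.+1 : cochains H) : seq H -> F).
    by move=> s; rewrite -discrete_diffE -du.
  rewrite -duE; apply: (bar_diff_nseq F2 (tau2 h)) => s s1.
  by rewrite duE (normalized_mul u1 u2).
have [c [A [A1 AP]]] := partial_system_exists r tau2 wP wnz wv r.
exists tau, c, y, A; split=> //.
- by move=> h hh; rewrite /tau hh eqxx.
- by move=> i; have [] := yP i.
- by move=> i j ijr; have [|Ad dA _ _ _] := AP i j ijr; first by lia.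
Qed.

End FiniteLevel.

(** * Massey vanishing for real projective groups *)

Lemma pullback_inj (G : topologicalGroupType) (H : finGroupType) (F : fieldType)
    (phi : G -> H) (phic : continuous (phi : G -> discrete_topology H)) :
  (forall h, exists g, phi g = h) -> injective (@pullback G H F phi phic).
Proof.
move=> /choice[s sK] f g fg; apply: cochainE => t.
have := congr1 (fun f : cochain G F => f (map s t)) fg.
by rewrite !pullbackE -map_comp (eq_map (g := id)) ?map_id.
Qed.

Lemma descend_cochains (G : topologicalGroupType) (F : fieldType) (J : finType)
    (f : J -> cochain_dga G F) (e : J -> int) : compact [set: G] ->
    (forall j, dg_homog (e j) (f j)) ->
  exists (H : finGroupType) (phi : G -> H)
    (phic : continuous (phi : G -> discrete_topology H)),
    [/\ {morph phi : x y / (x * y)%g}, forall h, exists g, phi g = h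
      & forall j, exists2 f' : cochain_dga (discrete_group H) F,
          dg_homog (e j) f' & pullback phic f' = f j].
Proof.
move=> Gc fe.
have fn j : of_size (absz (e j)) (f j : cochain G F).
  by move=> s se; apply: (fe j); apply: contra se => /eqP <-.
have fc j : continuous_in_degree (f j : cochain G F) (absz (e j)).
  by have /cochainP[_] := cochain_fun_subproof (f j : cochain G F); apply.
have [H [phi [phiM phis phic phif]]] := finite_quotient_factor Gc fn fc.
exists H, phi, phic; split=> // j; have /choice[s sK] := phis.
pose g (t : seq H) : F := (f j : cochain G F) (map s t).
have gn : of_size (absz (e j)) g by move=> t te; apply: fn; rewrite size_map.
exists (discrete_cochain gn) => [t te|].
  by apply: (fe j); rewrite size_map.
apply: cochainE => t; rewrite pullbackE /= /g; apply: phif.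
by rewrite -!map_comp; apply: eq_map => x /=; rewrite sK.
Qed.

(** There are no cochains of negative degree, and those of degree 0 are the
    constants. *)
Lemma cochain_homog_le0 (G : topologicalGroupType) (F : fieldType) d
    (x : cochain_dga G F) : dg_homog d x -> x <> 0 -> ~ 1 <= d ->
  exists2 c : F, c != 0 & d = 0 /\ x = c *: 1.
Proof.
move=> xd x0 d1; have xs (s : seq G) : s != [::] -> (x : cochain G F) s = 0.
  by move=> s0; apply: xd; case: s s0 => // g s _; apply/eqP => /= sd; apply: d1; lia.
have xE : x = ((x : cochain G F) [::] : F) *: 1.
  apply: cochainE => s; rewrite cochain_scaleE /= /cochain_one_fun.
  have [->|s0] := eqVneq s [::]; first by rewrite mulr1.
  by rewrite xs //; case: s s0 => // *; rewrite mulr0.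
exists ((x : cochain G F) [::]).
  by apply/eqP => c0; apply: x0; rewrite xE c0 scale0r.
split=> //; apply/eqP; apply/negPn/negP => d0; apply: x0.
by rewrite xE (xd [::]) ?scale0r // eq_sym.
Qed.

(** A nonzero constant is invertible, so that its product with a class vanishes only
    if that class does. *)
Lemma cup_eq0_degree_gt0 (G : topologicalGroupType) (F : fieldType) d e
    (a : cohom (cochain_dga G F) d) (b : cohom (cochain_dga G F) e) :
  a <> 0 -> b <> 0 -> cup a b = 0 -> 1 <= d /\ 1 <= e.
Proof.
move=> a0 b0 ab; have [x [ax _]] := represents_exists a.
have [y [by_ _]] := represents_exists b.
have [u ud du] := represents_cup ax by_ ab.
have x0 : x <> 0.
  move=> xz; apply: a0; apply: represents_boundary ax _.
  by exists 0; [exact: dg_homog0|rewrite raddf0].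
have y0 : y <> 0.
  move=> yz; apply: b0; apply: represents_boundary by_ _.
  by exists 0; [exact: dg_homog0|rewrite raddf0].
have [xd _] := represents_homog ax; have [yd _] := represents_homog by_.
split; apply: contrapT => n1.
- have [c c0 [d0 xE]] := cochain_homog_le0 xd x0 n1.
  apply: b0; apply: represents_boundary by_ _; exists (c^-1 *: u).
    by apply: dg_homogZ; move: ud; rewrite d0 add0r.
  by rewrite linearZ /= du xE -scalerAl mul1r scalerA mulVf // scale1r.
- have [c c0 [e0 yE]] := cochain_homog_le0 yd y0 n1.
  apply: a0; apply: represents_boundary ax _; exists (c^-1 *: u).
    by apply: dg_homogZ; move: ud; rewrite e0 addr0.
  by rewrite linearZ /= du yE -scalerAr mulr1 scalerA mulVf // scale1r.
Qed.

(** The embedding problem is real because an element of order at most 2 which lifts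
    a nontrivial one is nontrivial. *)
Lemma real_projective_lift (G : profiniteGroupType) (H K : finGroupType)
    (phi : G -> H) (alpha : K -> H) : real_projective G ->
    {morph phi : x y / (x * y)%g} -> continuous (phi : G -> discrete_topology H) ->
    {morph alpha : x y / (x * y)%g} -> (forall h, exists x, alpha x = h) ->
    (forall h, (h * h)%g = 1%g -> exists2 x, (x * x)%g = 1%g & alpha x = h) ->
  exists psi : G -> K, [/\ {morph psi : x y / (x * y)%g},
    continuous (psi : G -> discrete_topology K) & forall g, alpha (psi g) = phi g].
Proof.
move=> [_ solve] phiM phic alphaM alphas alpha2.
pose phiG : {multiplicative G -> H} := HB.pack phi (isMultiplicative.Build G H phi phiM).
pose alphaG : {multiplicative K -> H} :=
  HB.pack alpha (isMultiplicative.Build K H alpha alphaM).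
have alpha1 : alpha 1%g = 1%g by apply: (mulgI (alpha 1%g)); rewrite -alphaM !mulg1.
have [|psi [psic psiE]] := solve (@EmbeddingProblem G _ _ phiG phic alphaG alphas).
  move=> t [_ tt] /= phit; have [|x xx xE] := alpha2 (phi t).
    by rewrite -phiM tt; apply: (mulgI (phi 1%g)); rewrite -phiM !mulg1.
  by exists x; split=> //; split=> // x1; apply: phit; rewrite -xE x1.
by exists psi; split=> //; exact: gmulfM.
Qed.

Theorem theorem1p8 (G : profiniteGroupType) (p : nat) (hp : prime p)
    (hG : real_projective G) :
  strong_massey_vanishing (cochain_dga G 'F_p).
Proof.
set C := cochain_dga G 'F_p; move=> n d a n2 aa.
have Gc : compact [set: G] := profinite_compact.
have /choice[z0 z0P] i := represents_exists (a i).
(* Zero is a legitimate value outside the range of indices which matter, and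
   makes all the conditions on consecutive classes hold there. *)
pose inr i := (1 <= i <= n)%N.
pose z i : C := if inr i then z0 i else 0.
have zd i : dg_homog (d i) (z i).
  rewrite /z; case: ifP => _; last exact: dg_homog0.
  by have [/represents_homog[]] := z0P i.
have dz i : dg_diff C (z i) = 0.
  rewrite /z; case: ifP => _; last exact: raddf0.
  by have [/represents_homog[]] := z0P i.
have /choice[u uP] i : exists u : C, dg_homog (d i + d i.+1 - 1) u /\
    dg_diff C u = z i * z i.+1.
  have [ii|ii] := boolP (inr i && inr i.+1); last first.
    exists 0; split; first exact: dg_homog0.
    rewrite raddf0 /z; move: ii; rewrite negb_and => /orP[] /negPf ->.
      by rewrite mul0r.
    by rewrite mulr0.
  have /andP[i1 i2] := ii; rewrite /z i1 i2.
  have [r1 _] := z0P i; have [r2 _] := z0P i.+1.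
  have [|v vd dv] := represents_cup r1 r2; last by exists v.
  by apply: aa; move: i1 i2; rewrite /inr; lia.
(* One finite quotient for the cocycles and for the primitives of their products. *)
pose fam (j : 'I_n.+2 * bool) : C := if j.2 then z j.1 else u j.1.
pose deg (j : 'I_n.+2 * bool) : int :=
  if j.2 then d j.1 else d j.1 + d j.1.+1 - 1.
have famd j : dg_homog (deg j) (fam j).
  by case: j => j []; [exact: zd|case: (uP j)].
have [H [phi [phic [phiM phis desc]]]] := descend_cochains Gc famd.
have pinj : injective (pullback (F := 'F_p) phic) := pullback_inj phis.
have pdiff (f : cochain_dga (discrete_group H) 'F_p) :
    pullback phic (dg_diff _ f) = dg_diff C (pullback phic f).
  exact: (@pullback_diff _ _ _ _ phic f phiM).
have /choice[zH zHP] (i : nat) : exists f : cochain_dga (discrete_group H) 'F_p,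
    dg_homog (d i) f /\ pullback phic f = z i.
  have [i2|i2] := ltnP i n.+2.
    by have [f fd fz] := desc (Ordinal i2, true); exists f.
  exists 0; split; first exact: dg_homog0.
  rewrite /z /inr ifN; last by lia.
  exact: pullback0.
have zH0 i : z i = 0 -> zH i = 0.
  by move=> zi; apply: pinj; have [_ ->] := zHP i; rewrite zi [RHS]pullback0.
have zHd i : dg_homog (d i) (zH i) by have [] := zHP i.
have dzH i : dg_diff _ (zH i) = 0.
  by apply: pinj; have [_ zE] := zHP i; rewrite pdiff zE dz [RHS]pullback0.
have znz i : zH i <> 0 -> zH i.+1 <> 0 -> 1 <= d i /\ 1 <= d i.+1.
  have [ii|ii _] := boolP (inr i.+1); last by case; apply: zH0; rewrite /z (negPf ii).
  have [i1|i1] := boolP (inr i); last by case; apply: zH0; rewrite /z (negPf i1).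
  move=> zi zi1; apply: (@cup_eq0_degree_gt0 _ _ _ _ (a i) (a i.+1)).
  - by move=> ai; apply/zi/zH0; rewrite /z i1; have [_ ->] := z0P i.
  - by move=> ai; apply/zi1/zH0; rewrite /z ii; have [_ ->] := z0P i.+1.
  - by apply: aa; move: i1 ii; rewrite /inr; lia.
have zz i : exists v : cochain_dga (discrete_group H) 'F_p, dg_diff _ v = zH i * zH i.+1.
  have [i2|i2] := ltnP i n.+2; last first.
    exists 0; rewrite raddf0 zH0 ?mul0r // /z /inr ifN //; lia.
  have [v _ vu] := desc (Ordinal i2, false); exists v; apply: pinj.
  have [_ duE] := uP i; have [_ zE] := zHP i; have [_ zE1] := zHP i.+1.
  by rewrite pdiff vu [RHS]pullbackM zE zE1 -duE.
have [tau [c [y [A [tauP yd A1 AP]]]]] := finite_massey_system n.+1 zHd dzH znz zz.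
(* [K] is the group of the cover [c]. *)
have [|psi [psiM psic psiE]] :=
  real_projective_lift hG phiM phic (@cover_mapM _ _ _ c) (cover_surj c).
  move=> h hh; exists (cover_lift c h); first exact: cover_lift2.
  by rewrite cover_liftK tauP.
have qdiff (f : cochain_dga (discrete_group (cover_group c)) 'F_p) :
    pullback psic (dg_diff _ f) = dg_diff C (pullback psic f).
  exact: (@pullback_diff _ _ _ _ psic f psiM).
have qc (f : cochain_dga (discrete_group H) 'F_p) :
    pullback psic (cover_pull c f) = pullback phic f.
  apply: cochainE => s; rewrite /= -map_comp; congr (_ _); apply: eq_map => g.
  exact: psiE.
pose B i j : C := pullback psic (A i j).
have Bob i j : pullback psic (obstruction d A i j) = obstruction d B i j.
  rewrite /obstruction [LHS](pullback_sum psic); apply: eq_bigr => k _.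
  by rewrite [LHS]pullbackM pullbackZ.
have dB i j : (i < j <= n.+1)%N -> dg_homog (massey_deg d i j) (B i j) /\
    dg_diff C (B i j) = obstruction d B i j.
  move=> ij; have [Ad dA] := AP i j ij; split; first exact: pullback_homog.
  by rewrite /B -qdiff dA Bob.
exists B.
  split=> [i j [i1 ij jn _]|i j [i1 ij jn _]|i /andP[i1 i_n]].
  - by have [|] := dB i j; rewrite ?ij.
  - by have [|] := dB i j; rewrite ?ij.
  - have -> : B i i.+1 = z0 i - dg_diff C (pullback phic (y i)).
      rewrite /B A1 qc -pdiff; have [_ zE] := zHP i.
      have -> : z0 i = z i by rewrite /z /inr i1 i_n.
      rewrite -zE; exact: cochainE.
    apply: represents_addd; first by have [] := z0P i.
    by apply: pullback_homog; exact: yd.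
have [|Bd dBE] := dB 1%N n.+1; first by lia.
(* The corner entry is a primitive of the Massey value. *)
have -> : massey_value n d B = dg_diff C (B 1%N n.+1) by rewrite dBE.
apply: represents_zero.
have -> : \sum_(1 <= s < n.+1) d s - n%:Z + 2 - 1 = massey_deg d 1 n.+1.
  by rewrite /massey_deg; lia.
exact: Bd.
Qed.
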